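(* Let $\mathcal{A}=(A,j_{\mathcal{A}})$ be a weakly effective partial pair, and let $\mathcal{G}_{\overline{\mathcal{A}}}$ be the graph model freely generated by $\mathcal{A}$. If there exists $E\subseteq A$ such that $E$ is co-r.e., $O_E\neq\emptyset$ and $E/\mathrm{Aut}(\mathcal{A})$ is finite (possibly empty), then the equational theory $\mathrm{Th}(\mathcal{G}_{\overline{\mathcal{A}}})$ is not r.e.
   Context: For a set $A$, $A^*$ is the set of finite subsets of $A$. A *partial pair* is $\mathcal{A}=(A,j_{\mathcal{A}})$ with $A$ a non-empty set and $j_{\mathcal{A}}:A^*\times A\to A$ a partial (possibly total) injection. A *total pair* $(G,i)$ has $G$ infinite and $i:G^*\times G\to G$ a total injection. An automorphism of $\mathcal{A}$ is a bijection $\theta:A\to A$ such that for all $(a,\alpha)\in A^*\times A$: $(a,\alpha)\in\mathrm{dom}(j_{\mathcal{A}})$ iff $(\theta(a),\theta(\alpha))\in\mathrm{dom}(j_{\mathcal{A}})$ (with $\theta(a)$ the image set), and then $\theta(j_{\mathcal{A}}(a,\alpha))=j_{\mathcal{A}}(\theta(a),\theta(\alpha))$; $\mathrm{Aut}(\mathcal{A})$ is the group of automorphisms and $E/\mathrm{Aut}(\mathcal{A})$ is the set of orbits of elements of $E$. $\mathcal{A}$ is *weakly effective* if it is isomorphic to a pair $(E_0,\ell)$ with $E_0$ a decidable subset of $\mathbb{N}$ and $\ell:E_0^*\times E_0\to E_0$ partial recursive with decidable domain (finite sets being effectively coded); here an isomorphism from $\mathcal{A}$ to $(E_0,\ell)$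 is a bijection $\theta:A\to E_0$ such that for all $(a,\alpha)\in A^*\times A$: $(a,\alpha)\in\mathrm{dom}(j_{\mathcal{A}})$ iff $(\theta(a),\theta(\alpha))\in\mathrm{dom}(\ell)$ (with $\theta(a)$ the image set), and then $\theta(j_{\mathcal{A}}(a,\alpha))=\ell(\theta(a),\theta(\alpha))$. Convention: weakly effective pairs are identified with such a pair, so $A$ is a decidable subset of $\mathbb{N}$, and ''$E$ co-r.e.'' means that $E$ is a co-r.e. subset of $\mathbb{N}$. The *graph model* with web $(G,i)$ is the $\lambda$-model carried by $\mathcal{P}(G)$ ordered by inclusion, in which for $\rho:\mathrm{Var}\to\mathcal{P}(G)$ untyped $\lambda$-terms are interpreted by $|x|_\rho=\rho(x)$, $|MN|_\rho=\{\alpha\in G:\exists a\subseteq|N|_\rho\text{ finite},\ i(a,\alpha)\in|M|_\rho\}$, $|\lambda x.M|_\rho=\{i(a,\alpha):a\in G^*,\ \alpha\in|M|_{\rho[x:=a]}\}$; for closed $M$ the value $|M|$ does not depend on $\rho$. Its equational theory is $\{(M,N):|M|_\rho=|N|_\rho\ \forall\rho\}$; it is r.e. if its set of Gödel codes is r.e. The *free completion* of $\mathcal{A}$ (where no element of $A$ is an ordered pair) is the total pair $\overline{\mathcal{A}}=(\overline{A},i_{\overline{\mathcal A}})$ with $\overline{A}=\bigcup_n A_n$, $A_0=A$, $A_{n+1}=A\cup((A_n^*\times A_n)\setminus\mathrm{dom}(j_{\mathcal{A}}))$, and $i_{\overline{\mathcal A}}(a,\alpha)=j_{\mathcal{A}}(a,\alpha)$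 if $(a,\alpha)\in\mathrm{dom}(j_{\mathcal{A}})$, $i_{\overline{\mathcal A}}(a,\alpha)=(a,\alpha)$ otherwise. $\mathcal{G}_{\overline{\mathcal{A}}}$ is the graph model with web $\overline{\mathcal{A}}$. For $E\subseteq A$, $O_E$ is the set of closed $\lambda$-terms $N$ whose interpretation in $\mathcal{G}_{\overline{\mathcal{A}}}$ satisfies $|N|\subseteq E$. *)

(* Defs.v *)
From HB Require Import structures.
From Stdlib Require Cantor.
From mathcomp Require Import all_boot finmap.
From mathcomp Require Import boolp classical_sets functions cardinality.

Set Implicit Arguments.
Unset Strict Implicit.
Unset Printing Implicit Defensive.

Local Open Scope classical_set_scope.

(** * Computability on the natural numbers *)

(* Kleene's partial recursive functions.  Arities are not tracked: an argument
   list is read as padded with zeros, so that the k-ary functions computed on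
   lists of length k are exactly the k-ary partial recursive functions. *)
Inductive recfun : Type :=
  | rzero
  | rsucc
  | rproj of nat
  | rcomp of recfun & seq recfun
  | rprec of recfun & recfun
  | rmin of recfun.

Fixpoint pointwise (S T : Type) (P : S -> T -> Prop) (s : seq S) (t : seq T) :
    Prop :=
  match s, t with
  | [::], [::] => True
  | x :: s', y :: t' => P x y /\ pointwise P s' t'
  | _, _ => False
  end.

Fixpoint prec_graph (base : nat -> Prop) (step : nat -> nat -> nat -> Prop)
    (n z : nat) : Prop :=
  if n is m.+1 then exists2 r, prec_graph base step m r & step m r z
  else base z.

(* [eval f xs z]: the computation of [f] on [xs] converges to [z]. *)
Fixpoint eval (f : recfun) (xs : seq nat) (z : nat) : Prop :=
  match f with
  | rzero => z = 0
  | rsucc => z = (head 0 xs).+1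
  | rproj i => z = nth 0 xs i
  | rcomp g hs =>
      exists2 ys, pointwise (fun h y => eval h xs y) hs ys & eval g ys z
  | rprec g h =>
      prec_graph (fun r => eval g (behead xs) r)
        (fun m r r' => eval h [:: m, r & behead xs] r') (head 0 xs) z
  | rmin g =>
      eval g (z :: xs) 0 /\ forall k, k < z -> exists m, eval g (k :: xs) m.+1
  end.

Definition recursive_set (P : set nat) : Prop :=
  exists c, forall n, eval c [:: n] (`[< P n >] : bool).

Definition re_set (P : set nat) : Prop :=
  exists c, forall n, P n <-> exists z, eval c [:: n] z.

Definition co_re_set (P : set nat) : Prop := re_set (~` P).

(* The canonical coding of finite sets of numbers, a bijection onto [nat]. *)
Definition fset_code (a : {fset nat}) : nat := \sum_(x <- enum_fset a) 2 ^ x.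

(** * Partial and total pairs *)

(* The underlying sets are subsets of an ambient type; [pfun] is undefined
   ([None]) outside of its domain, which is part of A^* x A. *)
Record partial_pair (U : choiceType) := PartialPair {
  pcarrier :> set U;
  pfun : {fset U} -> U -> option U;
  pcarrier_neq0 : pcarrier !=set0;
  pfun_closed : forall a x y, pfun a x = Some y ->
    [/\ [set` a] `<=` pcarrier, pcarrier x & pcarrier y];
  pfun_inj : forall a x b y z,
    pfun a x = Some z -> pfun b y = Some z -> a = b /\ x = y }.

(* The values of [tfun] outside of G^* x G are irrelevant. *)
Record total_pair (V : choiceType) := TotalPair {
  tcarrier :> set V;
  tfun : {fset V} -> V -> V;
  tcarrier_infinite : infinite_set tcarrier;
  tfun_closed : forall a x, [set` a] `<=` tcarrier -> tcarrier x ->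
    tcarrier (tfun a x);
  tfun_inj : forall a x b y,
    [set` a] `<=` tcarrier -> tcarrier x ->
    [set` b] `<=` tcarrier -> tcarrier y ->
    tfun a x = tfun b y -> a = b /\ x = y }.

(* Only the restriction of [th] to A matters. *)
Definition isomorphism (U V : choiceType) (A : partial_pair U)
    (B : partial_pair V) (th : U -> V) : Prop :=
  set_bij A B th /\
  forall (a : {fset U}) (x : U), [set` a] `<=` A -> pcarrier A x ->
    (pfun A a x <-> pfun B [fset th y | y in a]%fset (th x)) /\
    (forall z, pfun A a x = Some z ->
       pfun B [fset th y | y in a]%fset (th x) = Some (th z)).

Definition automorphism (U : choiceType) (A : partial_pair U) (th : U -> U) :
    Prop := isomorphism A A th.

Definition aut_orbit (U : choiceType) (A : partial_pair U) (x : U) : set U :=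
  [set th x | th in automorphism A].

(* E / Aut(A), the set of the orbits of the elements of E. *)
Definition aut_orbits (U : choiceType) (A : partial_pair U) (E : set U) :
    set (set U) := [set aut_orbit A x | x in E].

Definition effective_pair (B : partial_pair nat) : Prop :=
  [/\ recursive_set B,
      exists c, forall (a : {fset nat}) (x z : nat),
        pfun B a x = Some z <-> eval c [:: fset_code a; x] z
    & exists d, forall (a : {fset nat}) (x : nat),
        eval d [:: fset_code a; x] (pfun B a x : bool)].

(* A weakly effective pair is given together with the effective pair [B] on
   the natural numbers with which it is identified, through [th]. *)
Definition weakly_effective_via (U : choiceType) (A : partial_pair U)
    (B : partial_pair nat) (th : U -> nat) : Prop :=
  effective_pair B /\ isomorphism A B th.

(** * Lambda-terms and graph models *)

Inductive term : Type :=
  | Var of nat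
  | App of term & term
  | Lam of nat & term.

Fixpoint free_vars (M : term) : seq nat :=
  match M with
  | Var x => [:: x]
  | App M N => free_vars M ++ free_vars N
  | Lam x M => [seq y <- free_vars M | y != x]
  end.

Definition closed_term (M : term) : Prop := free_vars M = [::].

Fixpoint godel (M : term) : nat :=
  match M with
  | Var x => Cantor.to_nat (0, x)
  | App M N => Cantor.to_nat (1, Cantor.to_nat (godel M, godel N))
  | Lam x M => Cantor.to_nat (2, Cantor.to_nat (x, godel M))
  end.

Section GraphModel.
Variables (V : choiceType) (G : total_pair V).

Definition valuation (rho : nat -> set V) : Prop := forall x, rho x `<=` G.

Definition update (rho : nat -> set V) (x : nat) (X : set V) : nat -> set V :=
  fun y => if y == x then X else rho y.

Fixpoint interp (M : term) (rho : nat -> set V) : set V :=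
  match M with
  | Var x => rho x
  | App M N => [set v | tcarrier G v /\ exists a : {fset V},
                  [set` a] `<=` interp N rho /\ interp M rho (tfun G a v)]
  | Lam x M => [set w | exists (a : {fset V}) (v : V),
                  [/\ [set` a] `<=` G, interp M (update rho x [set` a]) v
                    & w = tfun G a v]]
  end.

(* The interpretation of a closed term, which does not depend on the
   valuation. *)
Definition closed_interp (M : term) : set V := interp M (fun=> set0).

Definition equational_theory : set (term * term) :=
  [set MN | forall rho, valuation rho -> interp MN.1 rho = interp MN.2 rho].

End GraphModel.

Definition re_theory (T : set (term * term)) : Prop :=
  re_set [set Cantor.to_nat (godel MN.1, godel MN.2) | MN in T].

(** * The free completion *)

Section Tree.
Variable U : Type.

(* A universe in which no atom is an ordered pair: an element x of A is
   renamed [Atom x], and the ordered pair of a finite set and an element is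
   [opair] below, in which the finite set is represented by its canonical
   enumeration.  The other values of [Node] never occur in the completion. *)
Inductive tree : Type :=
  | Atom of U
  | Node of seq tree & tree.

Fixpoint tree_encode (t : tree) : GenTree.tree U :=
  match t with
  | Atom x => GenTree.Leaf x
  | Node s t => GenTree.Node 0 (tree_encode t :: map tree_encode s)
  end.

Fixpoint tree_decode (t : GenTree.tree U) : option tree :=
  match t with
  | GenTree.Leaf x => Some (Atom x)
  | GenTree.Node _ (t :: s) => omap (Node (pmap tree_decode s)) (tree_decode t)
  | GenTree.Node _ [::] => None
  end.

Lemma tree_encodeK : pcancel tree_encode tree_decode.
Proof.
rewrite /pcancel; fix IH 1; case=> [x|s t] //=; rewrite IH /=; congr (Some (Node _ _)).
by elim: s => //= u s IHs; rewrite IH /= IHs.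
Qed.

Definition unatom (t : tree) : option U := if t is Atom x then Some x else None.

End Tree.

HB.instance Definition _ (U : choiceType) :=
  Choice.copy (tree U) (pcan_type (@tree_encodeK U)).

Lemma pair_infinite (V : choiceType) (G : set V) (f : {fset V} -> V -> V) :
  G !=set0 ->
  (forall a x, [set` a] `<=` G -> G x -> G (f a x)) ->
  (forall a x b y, [set` a] `<=` G -> G x -> [set` b] `<=` G -> G y ->
     f a x = f b y -> a = b /\ x = y) ->
  infinite_set G.
Proof.
move=> [x0 Gx0] fG finj /finite_fsetP[F GF].
have sub a : a \in fpowerset F -> [set` a] `<=` G.
  by rewrite fpowersetE GF => /fsubsetP aF x /= /aF.
have Finj : {in fpowerset F &, injective (f^~ x0)}.
  by move=> a b /sub aG /sub bG /finj[].
have : #|` [fset f a x0 | a in fpowerset F]%fset| <= #|` F|.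
  apply/fsubset_leq_card/fsubsetP => _ /imfsetP[a /= /sub aG ->].
  by have := fG _ _ aG Gx0; rewrite GF.
by rewrite card_in_imfset // card_fpowerset leqNgt ltn_expl.
Qed.

Section FreeCompletion.
Variables (U : choiceType) (A : partial_pair U).

Definition opair (a : {fset tree U}) (t : tree U) : tree U :=
  Node (enum_fset a) t.

(* The partial function j_A after this renaming, see [atom_funE]. *)
Definition atom_fun (a : {fset tree U}) (t : tree U) : option (tree U) :=
  if t is Atom x then
    let b := [fset y in pmap (@unatom U) (enum_fset a)]%fset in
    if a == [fset Atom y | y in b]%fset then omap (@Atom U) (pfun A b x)
    else None
  else None.

Fixpoint layer (n : nat) : set (tree U) :=
  if n is m.+1 then
    [set Atom x | x in A] `|`
    [set t | exists (a : {fset tree U}) (u : tree U),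
       [/\ [set` a] `<=` layer m, layer m u, atom_fun a u = None
         & t = opair a u]]
  else [set Atom x | x in A].

Definition completion_carrier : set (tree U) := \bigcup_n layer n.

Definition completion_fun (a : {fset tree U}) (t : tree U) : tree U :=
  odflt (opair a t) (atom_fun a t).

Lemma atom_funE (b : {fset U}) (x : U) :
  atom_fun [fset Atom y | y in b]%fset (Atom x) = omap (@Atom U) (pfun A b x).
Proof.
rewrite /atom_fun; set c := [fset y in pmap _ _]%fset.
suff -> : c = b by rewrite eqxx.
apply/fsetP => y; rewrite in_fset /= mem_pmap.
apply/mapP/idP => [[t /imfsetP[z /= zb ->] [->]]//|yb].
by exists (Atom y) => //; apply/imfsetP; exists y.
Qed.

Lemma atom_fun_some a t w : atom_fun a t = Some w ->
  exists b x z, [/\ a = [fset Atom y | y in b]%fset, t = Atom x, w = Atom z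
    & pfun A b x = Some z].
Proof.
case: t => //= x; set b := [fset y in _]%fset; case: eqP => // -> .
by case E: (pfun A b x) => [z|] //= [<-]; exists b, x, z.
Qed.

Lemma atom_fun_inj a t b u w :
  atom_fun a t = Some w -> atom_fun b u = Some w -> a = b /\ t = u.
Proof.
move=> /atom_fun_some[a' [x [z [-> -> -> h]]]].
by move=> /atom_fun_some[b' [y [z' [-> -> [<-] h']]]]; case: (pfun_inj h h') => -> ->.
Qed.

Lemma opair_inj a t b u : opair a t = opair b u -> a = b /\ t = u.
Proof. by case=> ab ->; split=> //; apply: val_inj. Qed.

Lemma layerS n : layer n `<=` layer n.+1.
Proof.
elim: n => [|n IH] t /=; first by left.
move=> [h|[a [u [h1 h2 h3 h4]]]]; [by left|right].
by exists a, u; split=> //; [move=> x /h1/IH | exact: IH].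
Qed.

Lemma layer_le m n : m <= n -> layer m `<=` layer n.
Proof.
move=> /subnK <-; elim: (n - m) => [//|k IH] t /IH; rewrite addSn; exact: layerS.
Qed.

Lemma layer_fset (a : {fset tree U}) :
  [set` a] `<=` completion_carrier -> exists n, [set` a] `<=` layer n.
Proof.
move=> aG.
suff [n h] : exists n, forall x, x \in enum_fset a -> layer n x by exists n.
have: forall x, x \in enum_fset a -> completion_carrier x by move=> x /aG.
elim: (enum_fset a) => [|x s IH] h; first by exists 0.
have [|n nP] := IH; first by move=> y ys; apply: h; rewrite inE ys orbT.
have [m _ mx] : completion_carrier x by apply: h; rewrite inE eqxx.
exists (maxn m n) => y; rewrite inE => /orP[/eqP->|/nP].
  by apply: layer_le mx; rewrite leq_maxl.
by apply: layer_le; rewrite leq_maxr.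
Qed.

Lemma completion_closed a t : [set` a] `<=` completion_carrier ->
  completion_carrier t -> completion_carrier (completion_fun a t).
Proof.
move=> /layer_fset[n na] [m _ mt]; rewrite /completion_fun.
case E: (atom_fun a t) => [w|] /=.
  have [b [x [z [_ _ -> /pfun_closed[_ _ Az]]]]] := atom_fun_some E.
  by exists 0 => //=; exists z.
exists (maxn m n).+1 => //; right; exists a, t; split=> //.
  by apply: subset_trans na _; apply: layer_le; rewrite leq_maxr.
by apply: layer_le mt; rewrite leq_maxl.
Qed.

Lemma completion_inj a t b u : completion_fun a t = completion_fun b u ->
  a = b /\ t = u.
Proof.
rewrite /completion_fun.
case E: (atom_fun a t) => [w|]; case F: (atom_fun b u) => [w'|] /=.
- by move=> ww; rewrite -ww in F; exact: atom_fun_inj E F.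
- by have [? [? [? [_ _ -> _]]]] := atom_fun_some E.
- by have [? [? [? [_ _ -> _]]]] := atom_fun_some F.
- exact: opair_inj.
Qed.

Lemma completion_infinite : infinite_set completion_carrier.
Proof.
apply: pair_infinite completion_closed _ => [|*]; last exact: completion_inj.
by have [x Ax] := pcarrier_neq0 A; exists (Atom x), 0 => //=; exists x.
Qed.

Definition free_completion : total_pair (tree U) :=
  TotalPair completion_infinite completion_closed
    (fun a t b u _ _ _ _ => @completion_inj a t b u).

(* O_E, for a subset E of A. *)
Definition closed_terms_below (E : set U) : set term :=
  [set N | closed_term N /\
           closed_interp free_completion N `<=` [set Atom x | x in E]].

End FreeCompletion.

(* Main.v *)
(* Automorphisms of the partial pair extend to its free completion and preserve
   the interpretations of closed terms.  Hence, for [N] in [O_E], the set [|N|]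
   is a union of orbits of [E]: only finitely many values occur, and [O_E] is a
   finite union of classes of the theory.  If the theory were r.e., [O_E] would
   be r.e.  On the other hand [O_E] is co-r.e., because membership in [|N|] is
   semidecidable (it is generated by typing rules, on suitable codes) and [E] is
   co-r.e.  By Scott's theorem, a set of closed terms that is recursive, nonempty
   and closed under equality in the model contains all closed terms; but the
   numerals have infinitely many distinct values. *)
From Stdlib Require Cantor.
Require Import Defs.
From mathcomp Require Import all_boot finmap zify.
From mathcomp Require Import boolp classical_sets functions cardinality.

Set Implicit Arguments.
Unset Strict Implicit.
Unset Printing Implicit Defensive.

Local Open Scope classical_set_scope.

Local Notation pr x y := (Cantor.to_nat (x, y)).

(** Convergence of programs, the carrier of the completion and membership in an interpretation are
    enumerated by one principle: a set generated by semidecidable rules with finitely many premises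
    is semidecidable. Two obstacles shape the coding. Codes of trees are faithful only on the
    carrier, so the derivations must ensure that the codes they meet come from carrier elements.
    Moreover, computing in the completion requires recognising that a pair lies outside the domain
    of [pfun]; this is a positive event because that domain is decidable. The reduction of [O_E] to
    finitely many classes is not uniform: representatives are chosen by excluded middle, and only
    their finite number matters for enumerability. Scott's argument is carried out on values in the
    model. The beta law is an equation between subsets of the web, so neither substitution nor
    renaming of bound variables arises. *)

Lemma pr_inj a b c d : pr a b = pr c d -> a = c /\ b = d.
Proof. by move=> /Cantor.to_nat_inj[]. Qed.

(** * Recursive functions *)

(** The recursion is nested in a list at [rcomp]; the [foldr] conjunction supplies the induction
    hypothesis for every function of that list. *)
Lemma recfun_nested_ind (P : recfun -> Prop) :
  P rzero -> P rsucc -> (forall i, P (rproj i)) ->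
  (forall g hs, P g -> foldr (fun h Q => P h /\ Q) True hs -> P (rcomp g hs)) ->
  (forall g h, P g -> P h -> P (rprec g h)) ->
  (forall g, P g -> P (rmin g)) -> forall f, P f.
Proof.
move=> h0 h1 h2 h3 h4 h5; fix IH 1; case=> [||i|g hs|g h|g].
- exact: h0.
- exact: h1.
- exact: h2.
- apply: h3; first exact: IH.
  by elim: hs => [//|h hs IHhs]; split; [exact: IH|exact: IHhs].
- by apply: h4; exact: IH.
- by apply: h5; exact: IH.
Qed.

Lemma eval_det f xs z z' : eval f xs z -> eval f xs z' -> z = z'.
Proof.
elim/recfun_nested_ind: f xs z z' => /=.
- by move=> _ ? ? -> ->.
- by move=> ? ? ? -> ->.
- by move=> ? ? ? ? -> ->.
- move=> g hs IHg IHhs xs z z' [ys hys gz] [ys' hys' gz'].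
  suff yy : ys = ys' by rewrite yy in gz; exact: IHg gz gz'.
  elim: hs ys ys' IHhs hys hys' {gz gz'} => [|h hs IH] [|y ys] [|y' ys'] //=.
  by move=> [IHh /IH{}IH] [hy /IH{}IH] [hy' /IH->]; rewrite (IHh _ _ _ hy hy').
- move=> g h IHg IHh xs z z'; elim: (head 0 xs) z z' => [|n IH] z z' /=.
    exact: IHg.
  by move=> [r /IH{}IH hr] [r' /IH rr]; rewrite rr in hr *; exact: IHh hr.
- move=> g IHg xs z z' [gz lz] [gz' lz'].
  case: (ltngtP z z') => // [/lz'[m]|/lz[m]].
    by move=> /(IHg _ _ _ gz).
  by move=> /(IHg _ _ _ gz').
Qed.

(** Argument lists carry no arity, yet a program reads only finitely many positions. Hence a
    list-valued map can be substituted by composing with finitely many programs. *)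
Lemma eval_finite_support f : exists N, forall xs ys z,
  (forall i, i < N -> nth 0 xs i = nth 0 ys i) -> eval f xs z -> eval f ys z.
Proof.
elim/recfun_nested_ind: f => /=.
- by exists 0.
- by exists 1 => xs ys z h ->; rewrite -!nth0 h.
- by move=> i; exists i.+1 => xs ys z h ->; rewrite h.
- move=> g hs _ IH.
  suff [N hN] : exists N, forall xs ys zs, (forall i, i < N -> nth 0 xs i = nth 0 ys i) ->
      pointwise (fun h y => eval h xs y) hs zs -> pointwise (fun h y => eval h ys y) hs zs.
    by exists N => xs ys z e [zs /(hN _ _ _ e) h1 h2]; exists zs.
  elim: hs IH => [|h hs IH] /=; first by exists 0 => ? ? [].
  move=> [[N1 h1] /IH[N2 h2]]; exists (maxn N1 N2) => xs ys [//|z zs] e [a b].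
  by split; [apply: h1 a|apply: h2 b] => i iN; apply: e; rewrite leq_max iN ?orbT.
- move=> g h [N1 h1] [N2 h2]; exists (maxn N1 N2).+1 => xs ys z e.
  have e' i : i < maxn N1 N2 -> nth 0 (behead xs) i = nth 0 (behead ys) i.
    by move=> iN; rewrite !nth_behead e.
  rewrite -!nth0 e //; elim: (nth 0 ys 0) z => [|n IH] z /=.
    by apply: h1 => i iN; apply: e'; rewrite leq_max iN.
  move=> [r /IH ? hr]; exists r => //; apply: h2 hr => -[|[|i]] iN //=.
  by apply: e'; rewrite leq_max; apply/orP; right; lia.
- move=> g [N h]; exists N => xs ys z e.
  have e' k i : i < N -> nth 0 (k :: xs) i = nth 0 (k :: ys) i.
    by case: i => //= i iN; apply: e; exact: ltnW.
  move=> [gz lz]; split; first exact: h (e' z) gz.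
  by move=> k /lz[m hm]; exists m; exact: h (e' k) hm.
Qed.

(** * Computable functions of padded argument lists *)

Definition computable (f : seq nat -> nat) : Prop :=
  exists c, forall xs, eval c xs (f xs).

(** Only the entries count: evaluation reads a list as padded with zeros and never observes its
    length. *)
Definition computable_env (e : seq nat -> seq nat) : Prop :=
  forall i, computable (fun xs => nth 0 (e xs) i).

Lemma pointwise_mkseq xs (cs : nat -> recfun) (f : nat -> nat) N :
  (forall i, eval (cs i) xs (f i)) ->
  pointwise (fun h y => eval h xs y) (mkseq cs N) (mkseq f N).
Proof. by move=> h; rewrite /mkseq; elim: (iota 0 N) => //= i s IH; split. Qed.

Lemma eval_env c e : computable_env e ->
  exists c', forall xs z, eval c' xs z <-> eval c (e xs) z.
Proof.
move=> /choice[cs hcs]; have [N hN] := eval_finite_support c.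
have hp xs : pointwise (fun h y => eval h xs y) (mkseq cs N)
    (mkseq (fun i => nth 0 (e xs) i) N).
  by apply: pointwise_mkseq => i; apply: hcs.
exists (rcomp c (mkseq cs N)) => xs z; split=> /=; last first.
  by move=> h; exists (mkseq (fun i => nth 0 (e xs) i) N) => //;
    apply: hN h => i ?; rewrite nth_mkseq.
move=> [ys hys]; apply: hN => i iN.
suff -> : ys = mkseq (fun i => nth 0 (e xs) i) N by rewrite nth_mkseq.
move: hys (hp xs); move: (mkseq cs N) (mkseq (fun i => nth 0 (e xs) i) N) => hs ys1.
elim: hs ys ys1 => [|h hs IH] [|y ys] [|y1 ys1] //=.
by move=> [hy /IH{}IH] [hy1 /IH->]; rewrite (eval_det hy hy1).
Qed.

Lemma computable_comp f e : computable f -> computable_env e ->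
  computable (fun xs => f (e xs)).
Proof.
move=> [c hc] /(eval_env c)[c' hc']; exists c' => xs; exact/hc'.
Qed.

Lemma env_id : computable_env (fun xs => xs).
Proof. by move=> i; exists (rproj i). Qed.

Lemma computable_nth i e : computable_env e -> computable (fun xs => nth 0 (e xs) i).
Proof. exact. Qed.

Lemma env_behead e : computable_env e -> computable_env (fun xs => behead (e xs)).
Proof.
by move=> h i; have [c hc] := h i.+1; exists c => xs; rewrite nth_behead.
Qed.

Lemma computable_const n : computable (fun=> n).
Proof.
elim: n => [|n [c hc]]; first by exists rzero.
by exists (rcomp rsucc [:: c]) => xs /=; exists [:: n].
Qed.

Lemma env_cons f e : computable f -> computable_env e ->
  computable_env (fun xs => f xs :: e xs).
Proof. by move=> hf he [|i] //=. Qed.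

Lemma env_nil : computable_env (fun=> [::]).
Proof. by move=> i; have [c hc] := computable_const 0; exists c => xs; rewrite nth_nil. Qed.

Lemma computable_ext f g : f =1 g -> computable f -> computable g.
Proof. by move=> fg [c hc]; exists c => xs; rewrite -fg. Qed.

(** [rprec] puts the counter and the previous value in front of the parameters, hence the two
    [behead]s. *)
Lemma computable_iteri n f g : computable n -> computable f ->
  computable (fun xs => g (nth 0 xs 0) (nth 0 xs 1) (behead (behead xs))) ->
  computable (fun xs => iteri (n xs) (fun m r => g m r xs) (f xs)).
Proof.
move=> hn [cf hf] [cg hg].
have : computable (fun xs => iteri (nth 0 xs 0) (fun m r => g m r (behead xs)) (f (behead xs))).
  exists (rprec cf cg) => xs /=; rewrite -nth0.
  elim: (nth 0 xs 0) => [|k IH] /=; first exact: hf.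
  by exists (iteri k (fun m r => g m r (behead xs)) (f (behead xs))) => //; exact: (hg [:: _, _ & _]).
move=> /computable_comp /(_ (env_cons hn env_id)).
exact: computable_ext.
Qed.

Lemma computable_S f : computable f -> computable (fun xs => (f xs).+1).
Proof. by move=> [c hc]; exists (rcomp rsucc [:: c]) => xs /=; exists [:: f xs]. Qed.

Ltac comp_var :=
  apply: computable_nth; repeat (first [apply: env_id | apply: env_behead]).

Lemma computable_add f g : computable f -> computable g ->
  computable (fun xs => f xs + g xs).
Proof.
move=> hf hg; apply: (@computable_ext (fun xs => iteri (f xs) (fun _ r => r.+1) (g xs))).
  by move=> xs; elim: (f xs) => //= n ->.
by apply: (computable_iteri (g := fun _ r _ => r.+1)) => //; apply: computable_S; comp_var.
Qed.

Lemma computable_mul f g : computable f -> computable g ->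
  computable (fun xs => f xs * g xs).
Proof.
move=> hf hg; apply: (@computable_ext (fun xs => iteri (f xs) (fun _ r => g xs + r) 0)).
  by move=> xs; elim: (f xs) => //= n ->; rewrite mulSn.
apply: (computable_iteri (g := fun _ r xs => g xs + r)) => //; first exact: computable_const.
by apply: computable_add; [apply: computable_comp hg _; do 2!apply: env_behead; exact: env_id|comp_var].
Qed.

Lemma computable_pred f : computable f -> computable (fun xs => (f xs).-1).
Proof.
move=> hf; apply: (@computable_ext (fun xs => iteri (f xs) (fun m _ => m) 0)).
  by move=> xs; case: (f xs).
by apply: (computable_iteri (g := fun m _ _ => m)) => //; [exact: computable_const|comp_var].
Qed.

Lemma computable_sub f g : computable f -> computable g ->
  computable (fun xs => f xs - g xs).
Proof.
move=> hf hg; apply: (@computable_ext (fun xs => iteri (g xs) (fun _ r => r.-1) (f xs))).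
  by move=> xs; elim: (g xs) => /= [|n ->]; rewrite ?subn0 ?subnS.
by apply: (computable_iteri (g := fun _ r _ => r.-1)) => //; apply: computable_pred; comp_var.
Qed.

Definition decidable_pred (p : seq nat -> bool) := computable (fun xs => p xs).

Lemma dec_leq f g : computable f -> computable g -> decidable_pred (fun xs => f xs <= g xs).
Proof.
move=> hf hg; apply: (@computable_ext (fun xs => 1 - (f xs - g xs))); first by move=> xs; lia.
by do ?apply: computable_sub => //; exact: computable_const.
Qed.

Lemma dec_neg p : decidable_pred p -> decidable_pred (fun xs => ~~ p xs).
Proof.
move=> hp; apply: (@computable_ext (fun xs => 1 - p xs)); first by move=> xs; case: (p xs).
by apply: computable_sub hp; exact: computable_const.
Qed.

Lemma dec_and p q : decidable_pred p -> decidable_pred q ->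
  decidable_pred (fun xs => p xs && q xs).
Proof.
move=> hp hq; apply: (@computable_ext (fun xs => p xs * q xs)).
  by move=> xs; rewrite mulnb.
exact: computable_mul.
Qed.

Lemma dec_ext p q : p =1 q -> decidable_pred p -> decidable_pred q.
Proof. by move=> pq; apply: computable_ext => xs; rewrite pq. Qed.

Lemma dec_or p q : decidable_pred p -> decidable_pred q ->
  decidable_pred (fun xs => p xs || q xs).
Proof.
move=> hp hq; apply: (@dec_ext (fun xs => ~~ (~~ p xs && ~~ q xs))).
  by move=> xs; rewrite negb_and !negbK.
by apply: dec_neg; apply: dec_and; apply: dec_neg.
Qed.

Lemma dec_eqn f g : computable f -> computable g -> decidable_pred (fun xs => f xs == g xs).
Proof.
move=> hf hg; apply: (@dec_ext (fun xs => (f xs <= g xs) && (g xs <= f xs))).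
  by move=> xs; rewrite -eqn_leq.
by apply: dec_and; apply: dec_leq.
Qed.

Lemma dec_eqb p q : decidable_pred p -> decidable_pred q ->
  decidable_pred (fun xs => p xs == q xs).
Proof.
move=> hp hq; apply: (@dec_ext (fun xs => (p xs : nat) == q xs)).
  by move=> xs; case: (p xs); case: (q xs).
exact: dec_eqn.
Qed.

(** * Bounded quantifiers *)

Definition bounded_ex (n : nat) (p : pred nat) : bool := iteri n (fun m r => r || p m) false.

Lemma bounded_exP n (p : pred nat) : reflect (exists2 m, m < n & p m) (bounded_ex n p).
Proof.
elim: n => [|n IH] /=; first by right=> -[].
apply: (iffP orP) => [[/IH[m mn pm]|pn]|[m]].
- by exists m => //; rewrite ltnS ltnW.
- by exists n.
- rewrite ltnS leq_eqVlt => /orP[/eqP->|mn] pm; [by right|].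
  by left; apply/IH; exists m.
Qed.

Lemma dec_bounded_ex n (p : nat -> seq nat -> bool) : computable n ->
  decidable_pred (fun xs => p (nth 0 xs 0) (behead xs)) ->
  decidable_pred (fun xs => bounded_ex (n xs) (p^~ xs)).
Proof.
move=> hn hp; apply: (@computable_ext
  (fun xs => iteri (n xs) (fun m r => 1 - (1 - r) * (1 - p m xs)) 0)).
  by move=> xs; rewrite /bounded_ex; elim: (n xs) => //= k ->; case: (iteri _ _ _); case: (p _ _).
apply: (computable_iteri (g := fun m r xs => 1 - (1 - r) * (1 - p m xs))) => //.
  exact: computable_const.
apply: computable_sub; [exact: computable_const|apply: computable_mul].
  by apply: computable_sub; [exact: computable_const|comp_var].
apply: computable_sub; first exact: computable_const.
(* The previous value, at position 1, is dropped so that [p] sees only the counter and the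
   parameters. *)
have -> : (fun xs => nat_of_bool (p (nth 0 xs 0) (behead (behead xs)))) =
  (fun xs => nat_of_bool (p (nth 0 (nth 0 xs 0 :: behead (behead xs)) 0)
     (behead (nth 0 xs 0 :: behead (behead xs))))) by [].
by apply: (computable_comp hp); apply: env_cons; [comp_var|do 2!apply: env_behead; exact: env_id].
Qed.

Lemma dec_bounded_all n (p : nat -> seq nat -> bool) : computable n ->
  decidable_pred (fun xs => p (nth 0 xs 0) (behead xs)) ->
  decidable_pred (fun xs => ~~ bounded_ex (n xs) (fun m => ~~ p m xs)).
Proof.
move=> hn hp; apply: dec_neg.
by apply: (dec_bounded_ex (p := fun m xs => ~~ p m xs)) => //; apply: dec_neg.
Qed.

Lemma bounded_allP n (p : pred nat) :
  reflect (forall m, m < n -> p m) (~~ bounded_ex n (fun m => ~~ p m)).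
Proof.
apply: (iffP negP) => [h m mn|h /bounded_exP[m /h->//]].
by apply/negPn/negP => pm; apply: h; apply/bounded_exP; exists m.
Qed.

Lemma dec_odd f : computable f -> decidable_pred (fun xs => odd (f xs)).
Proof.
move=> hf; apply: (@computable_ext (fun xs => iteri (f xs) (fun _ r => 1 - r) 0)).
  by move=> xs; elim: (f xs) => //= n ->; case: odd.
apply: (computable_iteri (g := fun _ r _ => 1 - r)) => //; first exact: computable_const.
by apply: computable_sub; [exact: computable_const|comp_var].
Qed.

Lemma computable_half f : computable f -> computable (fun xs => (f xs)./2).
Proof.
move=> hf; apply: (@computable_ext (fun xs => iteri (f xs) (fun m r => odd m + r) 0)).
  by move=> xs; elim: (f xs) => //= n ->; rewrite uphalf_half.
apply: (computable_iteri (g := fun m r _ => odd m + r)) => //; first exact: computable_const.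
by apply: computable_add; [apply: dec_odd|]; comp_var.
Qed.

Lemma computable_double f : computable f -> computable (fun xs => (f xs).*2).
Proof.
move=> hf; apply: (@computable_ext (fun xs => f xs + f xs)); last exact: computable_add.
by move=> xs; rewrite addnn.
Qed.

Lemma computable_exp2 f : computable f -> computable (fun xs => 2 ^ f xs).
Proof.
move=> hf; apply: (@computable_ext (fun xs => iteri (f xs) (fun _ r => r + r) 1)).
  by move=> xs; elim: (f xs) => //= n ->; rewrite expnS mul2n addnn.
apply: (computable_iteri (g := fun _ r _ => r + r)) => //; first exact: computable_const.
by apply: computable_add; comp_var.
Qed.

Lemma computable_pr f g : computable f -> computable g ->
  computable (fun xs => pr (f xs) (g xs)).
Proof.
(* Closed form of the Cantor pairing: the second component plus the triangular number of the sum,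
   doubled and then halved. *)
move=> hf hg; apply: (@computable_ext
  (fun xs => (g xs + g xs + (g xs + f xs) * (g xs + f xs).+1)./2)).
  move=> xs; have := Cantor.to_nat_spec (f xs) (g xs); move: (pr _ _) => z; lia.
by apply: computable_half; do ?[apply: computable_add|apply: computable_mul|apply: computable_S].
Qed.

(** * Finite sets of numbers as bit sets *)

Definition bit (a n : nat) : bool := odd (iter n half a).

Lemma dec_bit f g : computable f -> computable g -> decidable_pred (fun xs => bit (f xs) (g xs)).
Proof.
move=> hf hg; apply: dec_odd.
apply: (@computable_ext (fun xs => iteri (g xs) (fun _ r => r./2) (f xs))).
  by move=> xs; elim: (g xs) => //= n ->.
by apply: (computable_iteri (g := fun _ r _ => r./2)) => //; apply: computable_half; comp_var.
Qed.

Lemma bitS a n : bit a n.+1 = bit a./2 n.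
Proof. by rewrite /bit iterSr. Qed.

(** This bound turns a quantifier over the elements of a coded set into a quantifier over the
    numbers below its code. *)
Lemma bit_lt a n : bit a n -> n < a.
Proof.
elim: n a => [|n IH] a; first by case: a.
by rewrite bitS => /IH; lia.
Qed.

Lemma bit0 n : bit 0 n = false.
Proof. by apply/negP => /bit_lt. Qed.

Lemma bit_ext a b : bit a =1 bit b -> a = b.
Proof.
have [n] := ubnP (a + b); elim: n a b => // n IH a b abn e.
have [ab0 | ab] := eqVneq (a + b) 0; first by lia.
have e0 : odd a = odd b by exact: e 0.
suff : a./2 = b./2 by move: e0; lia.
by apply: IH => [|m]; [lia|rewrite -!bitS e].
Qed.

Definition bitset (n : nat) (p : pred nat) : nat := iteri n (fun m r => r + p m * 2 ^ m) 0.

Lemma bitset_sum n p : bitset n p = \sum_(i < n) p i * 2 ^ i.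
Proof. by elim: n => [|n IH] /=; rewrite ?big_ord0 // big_ord_recr /= -IH. Qed.

Lemma bit_bitset n p m : bit (bitset n p) m = (m < n) && p m.
Proof.
rewrite bitset_sum; elim: n p m => [|n IH] p m; first by rewrite big_ord0 bit0.
have e : \sum_(i < n.+1) p i * 2 ^ i = p 0 + (\sum_(i < n) p i.+1 * 2 ^ i).*2.
  rewrite big_ord_recl /= expn0 muln1 -mul2n big_distrr; congr (_ + _).
  by apply: eq_bigr => i _; rewrite expnS mulnCA.
rewrite e; case: m => [|m]; first by rewrite /bit /= oddD odd_double addbF oddb.
rewrite bitS; set s := \sum_(i < n) _; have -> : (p 0 + s.*2)./2 = s by case: (p 0); lia.
by rewrite (IH (fun i => p i.+1)).
Qed.

Lemma fset_codeE (a : {fset nat}) n : bit (fset_code a) n = (n \in a).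
Proof.
pose N := \max_(x <- enum_fset a) x.+1.
have aN x : x \in a -> x < N by move=> xa; exact: (leq_bigmax_seq (F := succn)).
have -> : fset_code a = bitset N (fun x => x \in a).
  rewrite bitset_sum /fset_code.
  have -> : \sum_(i < N) (val i \in a) * 2 ^ i = \sum_(0 <= i < N | i \in a) 2 ^ i.
    rewrite big_mkord [RHS]big_mkcond; apply: eq_bigr => i _.
    by case: (_ \in a); rewrite ?mul1n ?mul0n.
  rewrite -[RHS]big_filter; apply: perm_big; apply: uniq_perm.
  - exact: fset_uniq.
  - by apply: filter_uniq; rewrite iota_uniq.
  - move=> x; rewrite mem_filter mem_index_iota /=.
    by apply/idP/andP => [xa|[]//]; split=> //; apply: aN.
by rewrite bit_bitset; apply: andb_idl => /aN.
Qed.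

Definition fset_of_code (a : nat) : {fset nat} := [fset n in iota 0 a | bit a n]%fset.

Lemma in_fset_of_code a n : (n \in fset_of_code a) = bit a n.
Proof.
rewrite !inE /= mem_iota /=; apply: andb_idl => /bit_lt; by rewrite add0n.
Qed.

Lemma fset_of_codeK a : fset_code (fset_of_code a) = a.
Proof. by apply: bit_ext => n; rewrite fset_codeE in_fset_of_code. Qed.

Lemma computable_bitset n (p : nat -> seq nat -> bool) : computable n ->
  decidable_pred (fun xs => p (nth 0 xs 0) (behead xs)) ->
  computable (fun xs => bitset (n xs) (p^~ xs)).
Proof.
move=> hn hp; apply: (computable_iteri (g := fun m r xs => r + p m xs * 2 ^ m)) => //.
  exact: computable_const.
apply: computable_add; first comp_var.
apply: computable_mul; last by apply: computable_exp2; comp_var.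
have -> : (fun xs => nat_of_bool (p (nth 0 xs 0) (behead (behead xs)))) =
  (fun xs => nat_of_bool (p (nth 0 (nth 0 xs 0 :: behead (behead xs)) 0)
     (behead (nth 0 xs 0 :: behead (behead xs))))) by [].
by apply: (computable_comp hp); apply: env_cons; [comp_var|do 2!apply: env_behead; exact: env_id].
Qed.

(** Syntax-directed. Under a binder the bound variable becomes entry 0 of the argument list, in the
    manner of de Bruijn indices, which is why the binder cases state their predicate explicitly. *)
Ltac comp_step := match goal with
  | |- computable_env (fun xs => xs) => exact: env_id
  | |- computable_env (fun xs => [::]) => exact: env_nil
  | |- computable_env (fun xs => behead (@?e xs)) => apply (@env_behead e)
  | |- computable_env (fun xs => @?f xs :: @?e xs) => apply (@env_cons f e)
  | |- computable (fun xs => nth 0 (@?e xs) ?i) => apply (@computable_nth i e)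
  | |- computable (fun xs => ?c) => exact: (@computable_const c)
  | |- computable (fun xs => (@?f xs).+1) => apply (@computable_S f)
  | |- computable (fun xs => (@?f xs).*2) => apply (@computable_double f)
  | |- computable (fun xs => (@?f xs)./2) => apply (@computable_half f)
  | |- computable (fun xs => @?f xs + @?g xs) => apply (@computable_add f g)
  | |- computable (fun xs => @?f xs - @?g xs) => apply (@computable_sub f g)
  | |- computable (fun xs => pr (@?f xs) (@?g xs)) => apply (@computable_pr f g)
  | |- decidable_pred (fun xs => ~~ @?p xs) => apply (@dec_neg p)
  | |- decidable_pred (fun xs => @?p xs && @?q xs) => apply (@dec_and p q)
  | |- decidable_pred (fun xs => @?p xs || @?q xs) => apply (@dec_or p q)
  | |- decidable_pred (fun xs => @?f xs <= @?g xs) => apply (@dec_leq f g)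
  | |- decidable_pred (fun xs => odd (@?f xs)) => apply (@dec_odd f)
  | |- decidable_pred (fun xs => bit (@?f xs) (@?g xs)) => apply (@dec_bit f g)
  | |- decidable_pred (fun xs => bounded_ex (@?n xs) (@?p xs)) =>
      refine (@dec_bounded_ex n (fun k xs => p xs k) _ _); cbv beta
  | |- computable (fun xs => bitset (@?n xs) (@?p xs)) =>
      refine (@computable_bitset n (fun k xs => p xs k) _ _); cbv beta
  | |- decidable_pred (fun xs => @eq_op _ (@?f xs) (@?g xs)) => apply (@dec_eqn f g)
  end.

Lemma dec_subst (p : nat -> seq nat -> bool) f e :
  decidable_pred (fun xs => p (nth 0 xs 0) (behead xs)) ->
  computable f -> computable_env e -> decidable_pred (fun xs => p (f xs) (e xs)).
Proof. by move=> hp hf he; exact: (computable_comp hp (env_cons hf he)). Qed.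

Lemma computable_tail f : computable f -> computable (fun xs => f (behead xs)).
Proof. by move=> hf; apply: computable_comp hf (env_behead env_id). Qed.

Lemma env_tail e : computable_env e -> computable_env (fun xs => e (behead xs)).
Proof. by move=> he i; exact: computable_tail (he i). Qed.

(** * Semidecidable predicates *)

(** The Sigma-1 form, a projection of a decidable relation, rather than the convergence of a
    program: the closure properties then reduce to manipulations of boolean formulas. *)
Definition semidecidable (P : seq nat -> Prop) : Prop :=
  exists2 p : nat -> seq nat -> bool,
    decidable_pred (fun xs => p (nth 0 xs 0) (behead xs)) &
    forall xs, P xs <-> exists k, p k xs.

Lemma semi_ext P Q : (forall xs, P xs <-> Q xs) -> semidecidable P -> semidecidable Q.
Proof. by move=> PQ [p hp pP]; exists p => // xs; rewrite -PQ. Qed.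

Lemma semi_dec p : decidable_pred p -> semidecidable p.
Proof.
move=> hp; exists (fun _ => p) => [|xs]; first exact: computable_tail hp.
by split=> [|[]//]; exists 0.
Qed.

Lemma semi_env P e : semidecidable P -> computable_env e -> semidecidable (fun xs => P (e xs)).
Proof.
move=> [p hp pP] he; exists (fun k xs => p k (e xs)) => // .
by apply: (dec_subst hp); [repeat comp_step|exact: env_tail].
Qed.

Lemma semi_or P Q : semidecidable P -> semidecidable Q -> semidecidable (fun xs => P xs \/ Q xs).
Proof.
move=> [p hp pP] [q hq qQ]; exists (fun k xs => p k xs || q k xs); first exact: dec_or.
move=> xs; rewrite pP qQ; split=> [[[k h]|[k h]]|[k /orP[|]]].
- by exists k; rewrite h.
- by exists k; rewrite h orbT.
- by left; exists k.
- by right; exists k.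
Qed.

(** Two nested unbounded searches merge under one common bound [m], which avoids computing the
    inverse of a pairing. *)
Lemma semi_ex (P : nat -> seq nat -> Prop) :
  semidecidable (fun xs => P (nth 0 xs 0) (behead xs)) ->
  semidecidable (fun xs => exists k, P k xs).
Proof.
move=> [p hp pP].
exists (fun m xs => bounded_ex m (fun k => bounded_ex m (fun l => p l (k :: xs)))).
  apply: (dec_bounded_ex (p := fun k xs =>
    bounded_ex (nth 0 xs 0) (fun l => p l (k :: behead xs)))); first by repeat comp_step.
  apply: (dec_bounded_ex (p := fun l xs => p l (nth 0 xs 0 :: behead (behead xs))));
    first by repeat comp_step.
  by apply: (dec_subst hp); repeat comp_step.
move=> xs; split=> [[k /(pP (k :: xs))[l kl]]|[m /bounded_exP[k km /bounded_exP[l lm kl]]]].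
  exists (k + l).+1; apply/bounded_exP; exists k; first by rewrite ltnS leq_addr.
  by apply/bounded_exP; exists l; first rewrite ltnS leq_addl.
by exists k; apply/(pP (k :: xs)); exists l.
Qed.

Lemma semi_and P Q : semidecidable P -> semidecidable Q -> semidecidable (fun xs => P xs /\ Q xs).
Proof.
move=> [p hp pP] [q hq qQ].
apply: (@semi_ext (fun xs => exists k l, p k xs && q l xs)).
  move=> xs; rewrite pP qQ; split=> [[k [l /andP[? ?]]]|[[k ?] [l ?]]].
    by split; [exists k|exists l].
  by exists k, l; apply/andP.
do 2!apply: semi_ex; apply: semi_dec.
by comp_step; apply: dec_subst => //; repeat comp_step.
Qed.

(** Collection: finitely many existential witnesses have a common bound, so the unbounded quantifier
    moves to the front. *)
Lemma semi_ball (P : nat -> seq nat -> Prop) n : computable n ->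
  semidecidable (fun xs => P (nth 0 xs 0) (behead xs)) ->
  semidecidable (fun xs => forall k, k < n xs -> P k xs).
Proof.
move=> hn [p hp pP].
apply: (@semi_ext (fun xs => exists m,
    ~~ bounded_ex (n xs) (fun k => ~~ bounded_ex m (fun l => p l (k :: xs))))).
  move=> xs; split=> [[m /bounded_allP h] k /h/bounded_exP[l _ kl]|].
    by apply/(pP (k :: xs)); exists l.
  elim: (n xs) => [|N IH] h; first by exists 0; apply/bounded_allP.
  have [|m /bounded_allP hm] := IH; first by move=> k kN; apply: h; exact: ltnW.
  have /(pP (N :: xs))[l pl] := h N (ltnSn N).
  exists (maxn m l.+1); apply/bounded_allP => k; rewrite ltnS leq_eqVlt.
  move=> /orP[/eqP->|/hm/bounded_exP[l' l'm pl']]; apply/bounded_exP.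
    by exists l; first rewrite leq_max ltnSn orbT.
  by exists l'; first rewrite leq_max l'm.
apply: semi_ex; apply: semi_dec.
apply: (dec_bounded_all (p := fun k xs => bounded_ex (nth 0 xs 0) (fun l => p l (k :: behead xs))));
  first exact: computable_tail.
apply: (dec_bounded_ex (p := fun l xs => p l (nth 0 xs 0 :: behead (behead xs))));
  first by repeat comp_step.
by apply: (dec_subst hp); repeat comp_step.
Qed.

Lemma semi_eqn f g : computable f -> computable g -> semidecidable (fun xs => f xs = g xs).
Proof.
move=> hf hg; apply: (@semi_ext (fun xs => f xs == g xs)).
  by move=> xs; split=> /eqP.
by apply: semi_dec; exact: dec_eqn.
Qed.

(** * Semidecidable relations of fixed arity *)

Definition semi1 (P : nat -> Prop) := semidecidable (fun xs => P (nth 0 xs 0)).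
Definition semi2 (P : nat -> nat -> Prop) :=
  semidecidable (fun xs => P (nth 0 xs 0) (nth 0 xs 1)).
Definition semi3 (P : nat -> nat -> nat -> Prop) :=
  semidecidable (fun xs => P (nth 0 xs 0) (nth 0 xs 1) (nth 0 xs 2)).
Definition semi4 (P : nat -> nat -> nat -> nat -> Prop) :=
  semidecidable (fun xs => P (nth 0 xs 0) (nth 0 xs 1) (nth 0 xs 2) (nth 0 xs 3)).

Lemma semi1E P f : semi1 P -> computable f -> semidecidable (fun xs => P (f xs)).
Proof.
move=> hP hf; apply: (@semi_env _ (fun xs => [:: f xs]) hP).
by apply: env_cons => //; exact: env_nil.
Qed.

Lemma semi2E P f g : semi2 P -> computable f -> computable g ->
  semidecidable (fun xs => P (f xs) (g xs)).
Proof.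
move=> hP hf hg; apply: (@semi_env _ (fun xs => [:: f xs; g xs]) hP).
by do 2!apply: env_cons => //; exact: env_nil.
Qed.

Lemma semi3E P f g h : semi3 P -> computable f -> computable g -> computable h ->
  semidecidable (fun xs => P (f xs) (g xs) (h xs)).
Proof.
move=> hP hf hg hh; apply: (@semi_env _ (fun xs => [:: f xs; g xs; h xs]) hP).
by do 3!apply: env_cons => //; exact: env_nil.
Qed.

Lemma semi4E P f g h k : semi4 P -> computable f -> computable g -> computable h ->
  computable k -> semidecidable (fun xs => P (f xs) (g xs) (h xs) (k xs)).
Proof.
move=> hP hf hg hh hk; apply: (@semi_env _ (fun xs => [:: f xs; g xs; h xs; k xs]) hP).
by do 4!apply: env_cons => //; exact: env_nil.
Qed.

Ltac semi_step := match goal with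
  | |- semidecidable (fun xs => ex (@?P xs)) =>
      refine (@semi_ex (fun k xs => P xs k) _); cbv beta
  | |- semidecidable (fun xs => @?P xs /\ @?Q xs) => apply (@semi_and P Q)
  | |- semidecidable (fun xs => @?P xs \/ @?Q xs) => apply (@semi_or P Q)
  | |- semidecidable (fun xs => forall k, is_true (k < @?n xs) -> @?P xs k) =>
      refine (@semi_ball (fun k xs => P xs k) n _ _); cbv beta
  | |- semidecidable (fun xs => @?f xs = @?g xs :> nat) => apply (@semi_eqn f g)
  | |- semidecidable (fun xs => is_true (@?p xs)) => apply (@semi_dec p)
  | |- _ => comp_step
  end.

(** * Inductively generated sets *)

Section Generated.
Variable R : nat -> nat -> Prop.

(* [R c Q]: [c] follows from the finite set of premises coded by [Q]. *)
Inductive generated : nat -> Prop :=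
  Generated c Q : R c Q -> (forall q, bit Q q -> generated q) -> generated c.

End Generated.

(* Approximations from below: at stage [k], only conclusions, premises and
   witnesses bounded by [k] are taken into account. *)
Fixpoint stage (p : nat -> nat -> nat -> bool) (k : nat) : nat :=
  if k is m.+1 then
    bitset m (fun c => bounded_ex m (fun Q => bounded_ex m (fun w =>
      p w c Q && ~~ bounded_ex Q (fun q => ~~ (~~ bit Q q || bit (stage p m) q)))))
  else 0.

Lemma stageP (p : nat -> nat -> nat -> bool) m c : reflect
  (c < m /\ exists Q w, [/\ Q < m, w < m, p w c Q & forall q, bit Q q -> bit (stage p m) q])
  (bit (stage p m.+1) c).
Proof.
rewrite /= bit_bitset; apply: (iffP andP).
  move=> [cm /bounded_exP[Q Qm /bounded_exP[w wm /andP[pw /bounded_allP h]]]].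
  split=> //; exists Q, w; split=> // q qQ.
  by have := h q (bit_lt qQ); rewrite qQ.
move=> [cm [Q [w [Qm wm pw h]]]]; split=> //.
apply/bounded_exP; exists Q => //; apply/bounded_exP; exists w => //.
rewrite pw; apply/bounded_allP => q _; case E: (bit Q q) => //=; exact: h.
Qed.

Lemma stage_le p m n c : m <= n -> bit (stage p m) c -> bit (stage p n) c.
Proof.
move=> /subnK <-; elim: (n - m) => // k IH /IH{IH}; rewrite addSn.
elim: (k + m) c => [|l IH] c; first by rewrite bit0.
move=> /stageP[cl [Q [w [Ql wl pw h]]]]; apply/stageP; split; first exact: ltnW.
exists Q, w; split=> //; [exact: ltnW|exact: ltnW|by move=> q /h/IH].
Qed.

Lemma generated_stage R (p : nat -> nat -> nat -> bool) : (forall c Q, R c Q <-> exists w, p w c Q) ->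
  forall c, generated R c <-> exists k, bit (stage p k) c.
Proof.
move=> pR c; split=> [|[k]].
  elim=> {}c Q /pR[w pw] _ IH.
  (* The premises are bits of [Q], hence finitely many; as stages increase, a single stage contains
     them all. *)
  have [m hm] : exists m, forall q, q < Q -> bit Q q -> bit (stage p m) q.
    elim: {1}Q => [|N [m hm]]; first by exists 0.
    case E: (bit Q N); last first.
      exists m => q; rewrite ltnS leq_eqVlt => /orP[/eqP->|]; [by rewrite E|exact: hm].
    have [m' hm'] := IH N E; exists (maxn m m') => q.
    rewrite ltnS leq_eqVlt => /orP[/eqP-> _|qN qQ].
      by apply: stage_le hm'; rewrite leq_maxr.
    by apply: stage_le (hm _ qN qQ); rewrite leq_maxl.
  (* One successor makes the bounds on [c], [Q] and [w] strict, the other is the passage to the next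
     stage. *)
  exists (m + c + Q + w).+2; apply/stageP; split; first by lia.
  exists Q, w; split=> //; [lia|lia|move=> q qQ].
  by apply: stage_le (hm q (bit_lt qQ) qQ); lia.
elim: k c => [|k IH] c; first by rewrite bit0.
move=> /stageP[_ [Q [w [_ _ pw h]]]]; apply: (@Generated R c Q) => [|q /h/IH//].
by apply/pR; exists w.
Qed.

(** Each approximation is a number, the bit set of the conclusions found so far, so the stages are
    computed by primitive recursion uniformly in the parameters. *)
Lemma semi_generated (R : seq nat -> nat -> nat -> Prop) :
  semidecidable (fun xs => R (behead (behead xs)) (nth 0 xs 0) (nth 0 xs 1)) ->
  semidecidable (fun xs => generated (R (behead xs)) (nth 0 xs 0)).
Proof.
move=> [p hp pR].
pose q (xs : seq nat) := fun w c Q => p w [:: c, Q & xs].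
apply: (@semi_ext (fun xs => exists k, bit (stage (q (behead xs)) k) (nth 0 xs 0))).
  move=> xs; symmetry; apply: generated_stage => c Q; exact: (pR [:: c, Q & behead xs]).
pose next r xs m := bitset m (fun c => bounded_ex m (fun Q => bounded_ex m (fun w =>
  q xs w c Q && ~~ bounded_ex Q (fun x => ~~ (~~ bit Q x || bit r x))))).
repeat semi_step; apply: (@computable_ext (fun xs =>
    iteri (nth 0 xs 0) (fun m r => next r (behead (behead xs)) m) 0)).
  by move=> xs; elim: (nth 0 xs 0) => //= n ->.
apply: (computable_iteri (g := fun m r xs => next r (behead (behead xs)) m)).
- by repeat comp_step.
- by repeat comp_step.
- by rewrite /next /q; repeat comp_step; apply: (dec_subst hp); repeat comp_step.
Qed.

Lemma semi1_generated (R : nat -> nat -> Prop) : semi2 R -> semi1 (generated R).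
Proof. by move=> hR; apply: (semi_generated (R := fun=> R)). Qed.

(** * Kleene's normal form *)

(** The graph of a primitive recursion is itself generated by rules with at most one premise, which
    dispenses with a coding of the sequence of intermediate values. *)
Lemma prec_graph_generated (base : nat -> Prop) (step : nat -> nat -> nat -> Prop) n z :
  prec_graph base step n z <->
  generated (fun c Q => (exists r, c = pr 0 r /\ base r) \/
    exists m r r', [/\ c = pr m.+1 r', bit Q (pr m r) & step m r r']) (pr n z).
Proof.
split.
  elim: n z => [|n IH] z /=.
    move=> bz; apply: (@Generated _ _ 0) => [|q]; last by rewrite bit0.
    by left; exists z.
  (* The bit set is the singleton of the only premise. *)
  move=> [r /IH hr srz]; apply: (@Generated _ _ (bitset (pr n r).+1 (pred1 (pr n r)))).
    by right; exists n, r, z; rewrite bit_bitset ltnSn /=.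
  by move=> q; rewrite bit_bitset => /andP[_ /eqP->].
move e : (pr n z) => c h; elim: h n z e => {}c Q hR _ IH n z.
case: hR => [[r [-> br]]|[m [r [r' [-> mr st]]]]].
  by move=> /pr_inj[-> ->].
by move=> /pr_inj[-> ->] /=; exists r => //; exact: (IH _ mr).
Qed.

Lemma semi_eval f : semidecidable (fun xs => eval f (behead xs) (nth 0 xs 0)).
Proof.
elim/recfun_nested_ind: f => /=.
- by repeat semi_step.
- apply: (@semi_ext (fun xs => nth 0 xs 0 = (nth 0 (behead xs) 0).+1)); last by repeat semi_step.
  by move=> xs; rewrite nth0.
- by move=> i; repeat semi_step.
- move=> g hs hg hhs.
  (* The values already obtained are carried as computable functions [fs] of the input. Each new
     value is a quantified entry at the head of the input, which shifts everything else; hence the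
     generalisation over [fs], [Z] and [X]. *)
  suff H (fs : seq (seq nat -> nat)) : foldr (fun f P => computable f /\ P) True fs ->
      forall Z X, computable Z -> computable_env X ->
      semidecidable (fun xs => exists2 ys, pointwise (fun h y => eval h (X xs) y) hs ys &
         eval g ([seq f xs | f <- fs] ++ ys) (Z xs)).
    by apply: (H [::] I); [comp_step; exact: env_id|exact: env_behead env_id].
  elim: hs hhs fs => [_|h hs IH [hh /IH{}IH]] fs hfs Z X hZ hX.
    apply: (@semi_ext (fun xs => eval g [seq f xs | f <- fs] (Z xs))).
      move=> xs; split=> [?|[[|]] //]; last by rewrite cats0.
      by exists [::] => //; rewrite cats0.
    apply: (@semi_env _ (fun xs => Z xs :: [seq f xs | f <- fs]) hg).
    apply: env_cons => //.
    by elim: fs hfs => [_|f fs IHf [hf /IHf hfs]] /=; [exact: env_nil|exact: env_cons].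
  apply: (@semi_ext (fun xs => exists y, eval h (X xs) y /\
     exists2 ys, pointwise (fun h y => eval h (X xs) y) hs ys &
         eval g ([seq f xs | f <- fs] ++ y :: ys) (Z xs))).
    move=> xs; split=> [[y [hy [ys hys gz]]]|[[|y ys] //= [hy hys] gz]].
      by exists (y :: ys).
    by exists y; split=> //; exists ys.
  repeat semi_step.
    apply: (@semi_env _ (fun xs => nth 0 xs 0 :: X (behead xs)) hh).
    by comp_step; [repeat comp_step|exact: env_tail].
  apply: (@semi_ext (fun xs => exists2 ys, pointwise (fun h y => eval h (X (behead xs)) y) hs ys &
       eval g ([seq f xs | f <- rcons [seq (fun xs => f (behead xs)) | f <- fs]
         (fun xs => nth 0 xs 0)] ++ ys) (Z (behead xs)))).
    by move=> xs; split=> -[ys a b]; exists ys => //; move: b;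
      rewrite map_rcons cat_rcons -map_comp.
  apply: (IH); [|exact: computable_tail|exact: env_tail].
  elim: fs hfs => [_|f fs IHf [hf /IHf hfs]] /=; first by split=> //; repeat comp_step.
  by split=> //; exact: computable_tail.
- move=> g h hg hh.
  apply: (@semi_ext (fun xs => generated (fun c Q =>
     (exists r, c = pr 0 r /\ eval g (behead (behead xs)) r) \/
    exists m r r', [/\ c = pr m.+1 r', bit Q (pr m r) & eval h [:: m, r & behead (behead xs)] r'])
     (pr (nth 0 xs 1) (nth 0 xs 0)))).
    by move=> xs; rewrite -prec_graph_generated -nth0 nth_behead.
  pose R xs c Q := (exists r, c = pr 0 r /\ eval g xs r) \/
    exists m r r', [/\ c = pr m.+1 r', bit Q (pr m r) & eval h [:: m, r & xs] r'].
  suff /semi_env : semidecidable (fun xs => generated (R (behead xs)) (nth 0 xs 0)).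
    move=> /(_ (fun xs => pr (nth 0 xs 1) (nth 0 xs 0) :: behead (behead xs))); apply.
    by repeat comp_step.
  apply: semi_generated; rewrite /R.
  apply: (@semi_ext (fun xs => (exists r, nth 0 xs 0 = pr 0 r /\ eval g (behead (behead xs)) r) \/
    exists m r r', nth 0 xs 0 = pr m.+1 r' /\ (bit (nth 0 xs 1) (pr m r) /\
      eval h [:: m, r & behead (behead xs)] r'))).
    move=> xs; split=> -[?|[m [r [r' H]]]]; [by left|right|by left|right].
      by exists m, r, r'; case: H => ? [].
    by exists m, r, r'; case: H => ? [].
  repeat semi_step.
    apply: (@semi_env _ (fun xs => nth 0 xs 0 :: behead (behead (behead xs))) hg).
    by repeat comp_step.
  apply: (@semi_env _ (fun xs => [:: nth 0 xs 0, nth 0 (behead (behead xs)) 0,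
    nth 0 (behead xs) 0 & behead (behead (behead (behead (behead xs))))]) hh).
  by repeat comp_step.
- move=> g hg; repeat semi_step.
    apply: (@semi_env _ (fun xs => 0 :: nth 0 xs 0 :: behead xs) hg).
    by repeat comp_step.
  refine (@semi_env _ (fun xs => [:: (nth 0 xs 0).+1,
    nth 0 (behead xs) 0 & behead (behead (behead xs))]) hg _).
  by repeat comp_step.
Qed.

Lemma semi_re_set (P : set nat) : re_set P -> semi1 P.
Proof.
move=> [c hc]; apply: (@semi_ext (fun xs => exists z, eval c [:: nth 0 xs 0] z)).
  by move=> xs; rewrite hc.
semi_step; apply: (@semi_env _ (fun xs => [:: nth 0 xs 0; nth 0 (behead xs) 0]) (semi_eval c)).
by repeat comp_step.
Qed.

(* Post's theorem; the two predicates need not be complementary outside of the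
   inputs of interest. *)
Lemma semi_separation P Q : semi1 P -> semi1 Q -> exists c, forall n, P n \/ Q n ->
  exists2 b : bool, eval c [:: n] b & if b then P n else Q n.
Proof.
move=> [p [cp hp] pP] [q hq qQ].
have [cr hr] : decidable_pred (fun xs => ~~ (p (nth 0 xs 0) (behead xs) || q (nth 0 xs 0) (behead xs))).
  by apply: dec_neg; apply: dec_or => //; exists cp.
(* The minimisation finds the first stage at which [p] or [q] succeeds; the answer is whether [p]
   does at that stage. *)
exists (rcomp cp [:: rmin cr; rproj 0]) => n PQ.
have /ex_minnP[k pqk kmin] : exists k, p k [:: n] || q k [:: n].
  by case: PQ => [/(pP [:: n])|/(qQ [:: n])] [k hk]; exists k; rewrite hk ?orbT.
exists (p k [:: n]).
  exists [:: k; n]; last exact: (hp [:: k; n]).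
  split; last by [].
  split; first by have := hr [:: k; n]; rewrite /= pqk.
  move=> l lk; exists 0; have := hr [:: l; n]; rewrite /=.
  by case E: (_ || _) => //; have := kmin _ E; rewrite leqNgt lk.
case E: (p k [:: n]); first by apply/(pP [:: n]); exists k.
by rewrite E in pqk; apply/(qQ [:: n]); exists k.
Qed.

(** * Graph models *)

Section Interpretation.
Variables (V : choiceType) (G : total_pair V).
Implicit Types (rho : nat -> set V) (M N : term).

Lemma update_valuation rho x X : valuation G rho -> X `<=` G -> valuation G (update rho x X).
Proof. by move=> hr hX y; rewrite /update; case: ifP. Qed.

Lemma interp_sub M rho : valuation G rho -> interp G M rho `<=` G.
Proof.
elim: M rho => [x|M IHM N IHN|x M IH] rho hr /=; first exact: hr.
  by move=> v [].
by move=> _ [a [v [ha hv ->]]]; apply: tfun_closed => //; apply: IH hv; apply: update_valuation.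
Qed.

Lemma interp_mono M rho rho' : (forall x, rho x `<=` rho' x) ->
  interp G M rho `<=` interp G M rho'.
Proof.
elim: M rho rho' => [x|M IHM N IHN|x M IH] rho rho' h /=; first exact: h.
  move=> v [Gv [a [ha hv]]]; split=> //; exists a; split; last exact: IHM hv.
  by move=> t /ha; apply: IHN.
move=> _ [a [v [ha hv ->]]]; exists a, v; split=> //; apply: IH hv => y.
by rewrite /update; case: ifP => _ //; exact: h.
Qed.

Lemma update_mono rho x (X Y : set V) : X `<=` Y -> forall y, update rho x X y `<=` update rho x Y y.
Proof. by move=> XY y; rewrite /update; case: ifP => _; [exact: XY|exact: subset_refl]. Qed.

Lemma updateC rho x y X Y : x != y ->
  update (update rho x X) y Y = update (update rho y Y) x X.
Proof.
move=> xy; apply/funext => z; rewrite /update; case: eqP => // ->; case: eqP => // yx.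
by rewrite yx eqxx in xy.
Qed.

Lemma updateK rho x X Y : update (update rho x X) x Y = update rho x Y.
Proof. by apply/funext => z; rewrite /update; case: eqP. Qed.

Lemma finite_support_union (P : V -> {fset V} -> Prop) (D : set V) (b : {fset V}) :
  (forall v (a a' : {fset V}), (a `<=` a')%fset -> P v a -> P v a') ->
  (forall v, v \in b -> exists2 a : {fset V}, [set` a] `<=` D & P v a) ->
  exists2 a : {fset V}, [set` a] `<=` D & forall v, v \in b -> P v a.
Proof.
move=> mono h.
suff [a aD ha] : exists2 a : {fset V}, [set` a] `<=` D & forall v, v \in enum_fset b -> P v a.
  by exists a.
have: forall v, v \in enum_fset b -> exists2 a : {fset V}, [set` a] `<=` D & P v a by [].
elim: (enum_fset b) => [|v s IH] hs; first by exists fset0.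
have [|a aD ha] := IH; first by move=> w ws; apply: hs; rewrite inE ws orbT.
have [|c cD hc] := hs v; first by rewrite inE eqxx.
exists (a `|` c)%fset => [t /=|w]; first by rewrite in_fsetU => /orP[/aD|/cD].
rewrite inE => /orP[/eqP->|/ha]; [exact: mono (fsubsetUr _ _) hc|exact: mono (fsubsetUl _ _)].
Qed.

(** Scott continuity in one variable: each application consults only a finite set, so finitely many
    elements of [D] account for any given element of the interpretation. *)
Lemma interp_cont M rho x (D : set V) v : interp G M (update rho x D) v ->
  exists2 a : {fset V}, [set` a] `<=` D & interp G M (update rho x [set` a]) v.
Proof.
have mono N rho' y (a a' : {fset V}) w : (a `<=` a')%fset ->
    interp G N (update rho' y [set` a]) w -> interp G N (update rho' y [set` a']) w.
  by move=> /fsubsetP aa'; apply: interp_mono; apply: update_mono => t /aa'.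
elim: M rho v => [y|M IHM N IHN|y M IH] rho v /=.
- rewrite /update; case: eqP => [_ Dv|_ hv]; last by exists fset0.
  by exists [fset v]%fset; [move=> t /= /fset1P->|rewrite /= inE].
- move=> [Gv [b [hb /IHM[a aD ha]]]].
  have [c cD hc] : exists2 c : {fset V}, [set` c] `<=` D &
      forall u, u \in b -> interp G N (update rho x [set` c]) u.
    by apply: finite_support_union => [u c c'|u /hb/IHN]; first exact: mono.
  exists (a `|` c)%fset; first by move=> t /=; rewrite in_fsetU => /orP[/aD|/cD].
  split=> //; exists b; split; last by apply: mono ha; exact: fsubsetUl.
  by move=> u /hc; apply: mono; exact: fsubsetUr.
- move=> [b [u [hb hu ->]]]; have [xy|xy] := eqVneq x y.
    (* The inner binder hides [x], so nothing of [D] is consulted. *)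
    exists fset0 => //; exists b, u; split=> //.
    by rewrite -xy updateK in hu *; rewrite updateK.
  rewrite updateC // in hu; have [a aD ha] := IH _ _ hu.
  by exists a => //; exists b, u; split=> //; rewrite updateC.
Qed.

Definition ap_set (X Y : set V) : set V :=
  [set v | tcarrier G v /\ exists a : {fset V}, [set` a] `<=` Y /\ X (tfun G a v)].

(** From left to right, injectivity of [tfun] recovers the finite set and the value, and
    monotonicity enlarges the set to [D]. The converse is continuity. *)
Lemma interp_beta M rho x D : valuation G rho -> D `<=` G ->
  ap_set (interp G (Lam x M) rho) D = interp G M (update rho x D).
Proof.
move=> hr DG; apply/seteqP; split=> v /=.
  move=> [Gv [a [ha [b [u [hb hu e]]]]]].
  have Gu : tcarrier G u by apply: interp_sub hu; exact: update_valuation.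
  have [ab uv] := tfun_inj (subset_trans ha DG) Gv hb Gu e.
  by rewrite -ab -uv in hu; apply: interp_mono hu; exact: update_mono.
move=> hv; split; first by apply: interp_sub hv; exact: update_valuation.
have [a aN ha] := interp_cont hv; exists a; split=> //; exists a, v; split=> //.
exact: subset_trans aN DG.
Qed.

Lemma interp_free_vars M rho rho' : (forall x, x \in free_vars M -> rho x = rho' x) ->
  interp G M rho = interp G M rho'.
Proof.
elim: M rho rho' => [x|M IHM N IHN|x M IH] rho rho' h /=.
- by apply: h; rewrite inE.
- rewrite (IHM rho rho') ?(IHN rho rho') // => y hy; apply: h; rewrite mem_cat hy ?orbT //.
- have e a : interp G M (update rho x a) = interp G M (update rho' x a).
    apply: IH => y hy; rewrite /update; case: eqP => // /eqP yx.
    by apply: h; rewrite mem_filter yx.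
  by apply/seteqP; split=> _ [a [v [ha hv ->]]]; exists a, v; rewrite ?e // -e.
Qed.

Lemma interp_closed M rho : closed_term M -> interp G M rho = closed_interp G M.
Proof. by move=> hM; apply: interp_free_vars => x; rewrite hM. Qed.

(** Bundling the inclusion in the carrier removes the side conditions of the beta law, which becomes
    an unconditional rewriting rule. *)
Definition domain := {X : set V | X `<=` G}.

Definition mkdomain (X : set V) (h : X `<=` G) : domain := exist (fun X => X `<=` G) X h.

Lemma domainP (X Y : domain) : sval X = sval Y -> X = Y.
Proof.
case: X Y => [X hX] [Y hY] /= XY; rewrite XY in hX *.
by congr (exist _ _ _); exact: Prop_irrelevance.
Qed.

Lemma ap_set_sub X Y : ap_set X Y `<=` G.
Proof. by move=> v []. Qed.

Definition ap (X Y : domain) : domain := mkdomain (@ap_set_sub (sval X) (sval Y)).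

Definition upd (r : nat -> domain) x d : nat -> domain := fun y => if y == x then d else r y.

Lemma sval_valuation (r : nat -> domain) : valuation G (fun x => sval (r x)).
Proof. by move=> x; exact: svalP (r x). Qed.

Definition den M (r : nat -> domain) : domain :=
  mkdomain (interp_sub (M := M) (@sval_valuation r)).

Lemma sval_upd r x d : (fun y => sval (upd r x d y)) = update (fun y => sval (r y)) x (sval d).
Proof. by apply/funext => y; rewrite /upd /update; case: ifP. Qed.

Lemma den_Var x r : den (Var x) r = r x. Proof. exact: domainP. Qed.

Lemma den_App M N r : den (App M N) r = ap (den M r) (den N r).
Proof. exact: domainP. Qed.

Lemma den_beta x M r d : ap (den (Lam x M) r) d = den M (upd r x d).
Proof.
by apply: domainP; rewrite /= sval_upd -interp_beta //; [exact: sval_valuation|exact: proj2_sig d].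
Qed.

(** The xi rule: an abstraction consults its body only at finite subsets of the carrier, and these
    are points of [domain]. *)
Lemma den_lam_ext x M N r r' :
  (forall d, den M (upd r x d) = den N (upd r' x d)) -> den (Lam x M) r = den (Lam x N) r'.
Proof.
move=> h; apply: domainP => /=.
have e (a : {fset V}) : [set` a] `<=` G -> interp G M (update (fun y => sval (r y)) x [set` a]) =
    interp G N (update (fun y => sval (r' y)) x [set` a]).
  move=> aG; have := congr1 sval (h (mkdomain aG)).
  by rewrite /= !sval_upd.
by apply/seteqP; split=> _ [a [v [ha hv ->]]]; exists a, v; split=> //; rewrite ?e // -e.
Qed.

Lemma set0_sub : set0 `<=` G. Proof. by []. Qed.

Definition bottom : domain := mkdomain set0_sub.
Definition top : domain := mkdomain (@subset_refl _ (tcarrier G)).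

Definition cden M := den M (fun=> bottom).

Lemma den_closed M r : closed_term M -> den M r = cden M.
Proof. by move=> hM; apply: domainP; rewrite /= !interp_closed. Qed.

End Interpretation.

(** * Representation of the recursive functions in a graph model *)

Definition tpair := Lam 0 (Lam 1 (Lam 2 (App (App (Var 2) (Var 0)) (Var 1)))).
Definition thead := Lam 0 (App (Var 0) (Lam 1 (Lam 2 (Var 1)))).
Definition ttail := Lam 0 (App (Var 0) (Lam 1 (Lam 2 (Var 2)))).
Definition tsucc := Lam 2 (Lam 0 (Lam 1 (App (Var 1) (Var 2)))).
(** Turing's fixed-point combinator. *)
Definition tfix :=
  let t := Lam 0 (Lam 1 (App (Var 1) (App (App (Var 0) (Var 0)) (Var 1)))) in App t t.

(** Scott numerals: a numeral performs its own case analysis and hands its predecessor to the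
    successor branch. *)
Fixpoint tnum (n : nat) : term :=
  Lam 0 (Lam 1 (if n is m.+1 then App (Var 1) (tnum m) else Var 0)).

(** The fixed point unfolds to a zero followed by itself, matching the convention that lists are
    padded with zeros. *)
Definition tzeros := App tfix (App tpair (tnum 0)).

(* A list of arguments, padded with zeros, is represented by an infinite
   stream of numerals. *)
Fixpoint rep (f : recfun) : term :=
  match f with
  | rzero => Lam 0 (tnum 0)
  | rsucc => Lam 0 (App tsucc (App thead (Var 0)))
  | rproj i => Lam 0 (App thead (iter i (App ttail) (Var 0)))
  | rcomp g hs => Lam 0 (App (rep g)
      (foldr (fun h t => App (App tpair (App (rep h) (Var 0))) t) tzeros hs))
  | rprec g h => Lam 0 (App (App (App tfix (Lam 1 (Lam 2 (Lam 3
        (App (App (Var 2) (App (rep g) (Var 3)))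
          (Lam 4 (App (rep h) (App (App tpair (Var 4))
             (App (App tpair (App (App (Var 1) (Var 4)) (Var 3))) (Var 3)))))))))
      ) (App thead (Var 0))) (App ttail (Var 0)))
  | rmin g => Lam 0 (App (App tfix (Lam 1 (Lam 2
        (App (App (App (rep g) (App (App tpair (Var 2)) (Var 0))) (Var 2))
           (Lam 3 (App (Var 1) (App tsucc (Var 2)))))))) (tnum 0))
  end.

Lemma closed_tnum n : closed_term (tnum n).
Proof. by elim: n => //= n IH; rewrite /closed_term /= IH. Qed.

Lemma closed_rep f : closed_term (rep f).
Proof.
rewrite /closed_term; elim/recfun_nested_ind: f => //=.
- by elim.
- move=> g hs -> /=; by elim: hs => //= h hs IH [-> /IH e]; exact: e.
- by move=> g h -> ->.
- by move=> g ->.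
Qed.

Section Combinators.
Variables (V : choiceType) (G : total_pair V).
Local Notation den := (@den V G).
Local Notation cden := (@cden V G).
Local Notation ap := (@ap V G).
Local Notation "x @ y" := (ap x y) (at level 50, left associativity).

Definition num n := cden (tnum n).

Definition denE := (den_App, den_Var, den_beta).

Lemma theadE a b : cden thead @ (cden tpair @ a @ b) = a.
Proof. by rewrite /cden !denE. Qed.

Lemma ttailE a b : cden ttail @ (cden tpair @ a @ b) = b.
Proof. by rewrite /cden !denE. Qed.

Lemma tfixE f : cden tfix @ f = f @ (cden tfix @ f).
Proof.
rewrite {1}/cden den_App; do 2!rewrite den_beta; do 3!rewrite den_App.
rewrite !den_Var /=; by [].
Qed.

Lemma num0E a b : num 0 @ a @ b = a.
Proof. by rewrite /num /cden !denE. Qed.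

Lemma numSE n a b : num n.+1 @ a @ b = b @ num n.
Proof. by rewrite /num {1}/cden /= !denE den_closed //; exact: closed_tnum. Qed.

Lemma tsuccE n : cden tsucc @ num n = num n.+1.
Proof.
rewrite {1}/cden den_beta; do 2!apply: den_lam_ext => ?.
by rewrite !denE den_closed //; exact: closed_tnum.
Qed.

Definition stream (xs : seq nat) := foldr (fun x s => cden tpair @ num x @ s) (cden tzeros) xs.

Lemma tzerosE : cden tzeros = cden tpair @ num 0 @ cden tzeros.
Proof.
have e : cden tzeros = cden tfix @ (cden tpair @ num 0) by rewrite [LHS]den_App den_App.
by rewrite {1}e tfixE -e.
Qed.

Lemma cden_beta x M d : cden (Lam x M) @ d = den M (upd (fun=> bottom G) x d).
Proof. exact: den_beta. Qed.

Lemma cden_App M N : cden (App M N) = cden M @ cden N.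
Proof. exact: den_App. Qed.

Lemma den_cden M r : closed_term M -> den M r = cden M.
Proof. exact: den_closed. Qed.

End Combinators.

(* The rewrite steps below would otherwise unify distinct terms by unfolding
   their interpretations. *)
Local Opaque cden den tnum tpair thead ttail tsucc tfix tzeros.

Section Representation.
Variables (V : choiceType) (G : total_pair V).
Local Notation den := (@den V G).
Local Notation cden := (@cden V G).
Local Notation ap := (@ap V G).
Local Notation num := (@num V G).
Local Notation stream := (@stream V G).
Local Notation "x @ y" := (ap x y) (at level 50, left associativity).

Lemma thead_stream xs : cden thead @ stream xs = num (head 0 xs).
Proof. by case: xs => [|x xs] /=; [rewrite {1}tzerosE|]; exact: theadE. Qed.

Lemma ttail_stream xs : cden ttail @ stream xs = stream (behead xs).
Proof. by case: xs => [|x xs] /=; [rewrite {1}tzerosE|]; exact: ttailE. Qed.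

Lemma den_combE r : (den tpair r = cden tpair) * (den thead r = cden thead) *
  (den ttail r = cden ttail) * (den tsucc r = cden tsucc) * (den tfix r = cden tfix) *
  (den tzeros r = cden tzeros).
Proof. by do !split; apply: den_cden. Qed.

Lemma den_tnum n r : den (tnum n) r = num n.
Proof. by apply: den_cden; exact: closed_tnum. Qed.

Lemma den_rep f r : den (rep f) r = cden (rep f).
Proof. by apply: den_cden; exact: closed_rep. Qed.

Lemma upd_eq (r : nat -> domain G) x d : upd r x d x = d.
Proof. by rewrite /upd eqxx. Qed.

Lemma upd_neq (r : nat -> domain G) x d y : y != x -> upd r x d y = r y.
Proof. by rewrite /upd => /negbTE->. Qed.

Ltac den_simp := repeat first [rewrite den_combE | rewrite den_tnum | rewrite den_rep
  | rewrite den_App | rewrite den_Var | rewrite upd_eq | rewrite upd_neq; last by [] ].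

(** Only convergent computations are represented. Primitive recursion and minimisation are fixed
    points whose body branches on a Scott numeral: the counter in the former, the tested value in
    the latter. *)
Lemma rep_correct f xs z : eval f xs z -> cden (rep f) @ stream xs = num z.
Proof.
elim/recfun_nested_ind: f xs z.
- by move=> xs _ ->; rewrite cden_beta den_tnum.
- by move=> xs _ ->; rewrite cden_beta; den_simp; rewrite thead_stream tsuccE.
- move=> i xs _ ->; rewrite cden_beta den_App den_combE.
  suff -> ys : den (iter i (App ttail) (Var 0)) (upd (fun=> bottom G) 0 (stream ys)) =
      stream (drop i ys) by rewrite thead_stream -nth0 nth_drop addn0.
  elim: i ys => [|i IH] ys /=; first by den_simp; rewrite drop0.
  by den_simp; rewrite IH ttail_stream -drop1 drop_drop.
- move=> g hs IHg IHhs xs z [ys hys gz].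
  rewrite cden_beta den_App den_rep.
  suff -> : den (foldr (fun h t => App (App tpair (App (rep h) (Var 0))) t) tzeros hs)
      (upd (fun=> bottom G) 0 (stream xs)) = stream ys by exact: IHg.
  elim: hs ys IHhs hys {gz} => [|h hs IH] [|y ys] //=; first by move=> _ _; exact: den_cden.
  by move=> [IHh /IH{}IH] [/IHh hy /IH{}IH]; den_simp; rewrite IH hy.
- move=> g h IHg IHh xs z /= hz.
  rewrite cden_beta; set T := Lam 1 _; den_simp; rewrite thead_stream ttail_stream.
  set F := den T _.
  elim: (head 0 xs) z hz => [|n IH] z /=; rewrite tfixE.
    move=> /IHg hz; rewrite {1}/F /T; do 3!rewrite den_beta; den_simp.
    by rewrite num0E.
  move=> [r /IH hr /IHh hz]; rewrite {1}/F /T; do 3!rewrite den_beta; den_simp.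
  rewrite numSE den_beta; den_simp.
  by rewrite hr.
- move=> g IHg xs z [gz lz].
  rewrite cden_beta; set T := Lam 1 _; den_simp.
  set F := den T _.
  have FE k : cden tfix @ F @ num k = cden (rep g) @ stream (k :: xs) @ num k @
      den (Lam 3 (App (Var 1) (App tsucc (Var 2))))
        (upd (upd (upd (fun=> bottom G) 0 (stream xs)) 1 (cden tfix @ F)) 2 (num k)).
    by rewrite {1}tfixE {1}/F /T; do 2!rewrite den_beta; den_simp.
  have base : cden tfix @ F @ num z = num z by rewrite FE (IHg _ _ gz) num0E.
  (* The search runs upwards and stops at [z], so the induction is on the distance to [z]. *)
  suff H k : k <= z -> cden tfix @ F @ num (z - k) = num z by rewrite -(subnn z) H.
  elim: k => [|k IH] kz; first by rewrite subn0.
  have [m /IHg hm] := lz (z - k.+1) ltac:(lia).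
  rewrite FE hm numSE den_beta; den_simp; rewrite tsuccE -IH; last exact: ltnW.
  by rewrite subnSK.
Qed.

Lemma num_inj : injective num.
Proof.
have num0S n : num 0 <> num n.+1.
  (* [s] is constantly the whole carrier. Applied to the empty set and [s], zero gives the empty set
     and a successor gives the carrier, which is infinite. *)
  pose s := den (Lam 0 (Var 1)) (upd (fun=> bottom G) 1 (top G)).
  move=> /(congr1 (fun x => x @ bottom G @ s)); rewrite num0E numSE /s den_beta; den_simp.
  move=> /(congr1 (@sval _ _)) /= e.
  by have := @tcarrier_infinite _ G; rewrite -e; apply; exact: finite_set0.
elim=> [|m IH] [|n] // => [/num0S//|/esym/num0S//|].
(* With the identity as successor branch, a numeral returns its predecessor. *)
move=> /(congr1 (fun x => x @ bottom G @ cden (Lam 0 (Var 0)))).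
by rewrite !numSE !cden_beta; den_simp => /IH->.
Qed.

End Representation.

(** * Scott's theorem *)

Lemma computable_godel_tnum f : computable f ->
  computable (fun xs => godel (tnum (f xs))).
Proof.
(* The iterated expression is the code of [Lam 0 (Lam 1 (App (Var 1) M))] when [r] is the code of
   [M]. *)
move=> hf; apply: (@computable_ext (fun xs => iteri (f xs)
    (fun _ r => pr 2 (pr 0 (pr 2 (pr 1 (pr 1 (pr (pr 0 1) r)))))) (godel (tnum 0)))).
  by move=> xs; elim: (f xs) => [|n IH] //; rewrite [LHS]/= IH.
apply: (computable_iteri
  (g := fun _ r _ => pr 2 (pr 0 (pr 2 (pr 1 (pr 1 (pr (pr 0 1) r))))))) => //.
  exact: computable_const.
by repeat comp_step.
Qed.

(** [P] and [Q] need to describe [O] and its complement only on codes of closed terms, so closedness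
    itself never has to be decided. *)
Theorem scott_undecidable (V : choiceType) (G : total_pair V) (O : term -> Prop)
    (P Q : nat -> Prop) M0 M1 :
  (forall M N, closed_term M -> closed_term N ->
     closed_interp G M = closed_interp G N -> O M -> O N) ->
  semi1 P -> semi1 Q ->
  (forall M, closed_term M -> P (godel M) <-> O M) ->
  (forall M, closed_term M -> Q (godel M) <-> ~ O M) ->
  closed_term M0 -> O M0 -> closed_term M1 -> O M1.
Proof.
move=> Oinv sP sQ PO QO cM0 OM0 cM1; apply: contrapT => OM1.
(* [J] decides its own membership in [O] and takes the opposite value. *)
pose diag n := pr 1 (pr n (godel (tnum n))).
have cdiag : computable (fun xs => diag (nth 0 xs 0)).
  by rewrite /diag; repeat first [apply: computable_godel_tnum | comp_step].
have [c hc] := @semi_separation (P \o diag) (Q \o diag) (semi1E sP cdiag) (semi1E sQ cdiag).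
(* The answer 0 selects [M0]; the answer 1 selects [M1], under a dummy abstraction that discards the
   predecessor handed over by the numeral. *)
pose X := Lam 0 (App (App (App (rep c) (App (App tpair (Var 0)) tzeros)) M0) (Lam 1 M1)).
pose J := App X (tnum (godel X)).
have cX : closed_term X by rewrite /closed_term /= closed_rep cM0 cM1.
have cJ : closed_term J.
  by rewrite /closed_term -[free_vars J]/(free_vars X ++ free_vars (tnum _)) cX closed_tnum.
have PJ : P (diag (godel X)) <-> O J := PO J cJ.
have QJ : Q (diag (godel X)) <-> ~ O J := QO J cJ.
have eJ (b : bool) : eval c [:: godel X] b ->
    closed_interp G J = closed_interp G (if b then M1 else M0).
  move=> hb; suff : cden G J = cden G (if b then M1 else M0) by move=> /(congr1 (@sval _ _)).
  rewrite /J cden_App {1}/X cden_beta; repeat first [rewrite den_combE | rewrite den_tnum | rewrite den_rep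
     | rewrite den_App | rewrite den_Var | rewrite upd_eq | rewrite (den_cden _ cM0)].
  rewrite (rep_correct G hb).
  case: {hb}b; first by rewrite numSE den_beta den_cden.
  by rewrite num0E.
have [|b /eJ e] := hc (godel X); first by rewrite /= PJ QJ; exact: EM.
case: b e => e /=; rewrite ?PJ ?QJ => hJ; first by apply: OM1; apply: Oinv hJ.
by apply: hJ; apply: Oinv OM0.
Qed.

(** * The free completion *)

Section Completion.
Variables (U : choiceType) (A : partial_pair U).
Local Notation G := (completion_carrier A).

Lemma completion_atom x : G (Atom x) <-> pcarrier A x.
Proof.
split=> [[[|n] _ /=]|Ax]; last by exists 0 => //=; exists x.
  by move=> [y Ay [<-]].
by move=> [[y Ay [<-]]//|[a [u [_ _ _]]]].
Qed.

(** The induction follows the layers: structural induction on trees would also meet nodes whose list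
    is not a canonical enumeration. *)
Lemma completion_ind (P : tree U -> Prop) :
  (forall x, pcarrier A x -> P (Atom x)) ->
  (forall a t, [set` a] `<=` G -> (forall u, u \in a -> P u) -> G t -> P t ->
     atom_fun A a t = None -> P (opair a t)) ->
  forall t, G t -> P t.
Proof.
move=> hA hP t [n _]; elim: n t => [|n IH] t /=; first by move=> [x Ax <-]; exact: hA.
move=> [[x Ax <-]|[a [u [ha hu au ->]]]]; first exact: hA.
apply: hP => //; [|by move=> v /ha/IH|by exists n|exact: IH].
by move=> v /ha; exists n.
Qed.

Lemma completion_opairI a t : [set` a] `<=` G -> G t -> atom_fun A a t = None -> G (opair a t).
Proof.
by move=> aG Gt at0; have := completion_closed aG Gt; rewrite /completion_fun at0.
Qed.

End Completion.

(** * Numerical codes for the free completion *)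

Definition seq_code (s : seq nat) : nat := fset_code [fset n in s]%fset.

Lemma bit_seq_code s n : bit (seq_code s) n = (n \in s).
Proof. by rewrite fset_codeE in_fset. Qed.

Section Coding.
Variables (U : choiceType) (A : partial_pair U) (B : partial_pair nat) (th : U -> nat).
Hypothesis iso : isomorphism A B th.
Local Notation G := (completion_carrier A).

(** Atoms get even codes and pairs odd ones. The list of a node is coded as a set, which forgets the
    canonical enumeration chosen in the type of trees. *)
Fixpoint tcode (t : tree U) : nat :=
  match t with
  | Atom x => (th x).*2
  | Node s t => (pr (seq_code (map tcode s)) (tcode t)).*2.+1
  end.

Definition scode (a : {fset tree U}) : nat := seq_code (map tcode (enum_fset a)).

Lemma tcode_opair a t : tcode (opair a t) = (pr (scode a) (tcode t)).*2.+1.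
Proof. by []. Qed.

Lemma bit_scodeP a n : reflect (exists2 t, t \in a & n = tcode t) (bit (scode a) n).
Proof. by rewrite bit_seq_code; exact: mapP. Qed.

Lemma th_inj x y : pcarrier A x -> pcarrier A y -> th x = th y -> x = y.
Proof. by case: iso => -[_ inj _] _ Ax Ay; apply: inj; rewrite inE. Qed.

(** The restriction to the carrier matters: two nodes with permuted lists have equal codes. *)
Lemma tcode_inj t u : G t -> G u -> tcode t = tcode u -> t = u.
Proof.
move=> Gt; elim/completion_ind: Gt u => [x Ax|a {}t aG IHa Gt IHt at0] u Gu.
  elim/completion_ind: Gu => [y Ay|b v _ _ _ _ _] /=; last by lia.
  by move=> /double_inj /th_inj ->.
elim/completion_ind: Gu => [y Ay|b v bG _ Gv _ bv]; first by rewrite tcode_opair /=; lia.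
rewrite !tcode_opair => /succn_inj/double_inj/pr_inj[ab tv].
rewrite (IHt v Gv tv); congr opair; apply/fsetP => w; apply/idP/idP => hw.
  have : bit (scode a) (tcode w) by apply/bit_scodeP; exists w.
  by rewrite ab => /bit_scodeP[w' w'b /(IHa _ hw _ (bG _ w'b)) ->].
have : bit (scode b) (tcode w) by apply/bit_scodeP; exists w.
rewrite -ab => /bit_scodeP[w' w'a e].
by rewrite -(IHa _ w'a _ (bG _ hw) (esym e)).
Qed.

Definition carrier_code (n : nat) : Prop := exists2 t, G t & tcode t = n.

Lemma scode_surj n : (forall k, bit n k -> carrier_code k) ->
  exists2 a : {fset tree U}, [set` a] `<=` G & scode a = n.
Proof.
move=> h.
(* An atom of [A] serves as default value outside the codes of carrier elements. *)
have /choice[g hg] : forall k, exists t, carrier_code k -> G t /\ tcode t = k.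
  move=> k; have [[t Gt tk]|nk] := EM (carrier_code k); first by exists t.
  by have [x Ax] := pcarrier_neq0 A; exists (Atom x).
exists [fset g k | k in fset_of_code n]%fset.
  by move=> _ /imfsetP[k /= kn ->]; rewrite in_fset_of_code in kn; have [] := hg _ (h _ kn).
apply: bit_ext => k; apply/bit_scodeP/idP => [[_ /imfsetP[l /= ln ->] ->]|kn].
  by rewrite in_fset_of_code in ln; have [_ ->] := hg _ (h _ ln).
exists (g k); last by have [_ ->] := hg _ (h _ kn).
by apply/imfsetP; exists k; rewrite //= in_fset_of_code.
Qed.

Lemma atoms_or_node (a : {fset tree U}) :
  (exists b : {fset U}, a = [fset Atom y | y in b]%fset) \/ exists s t, Node s t \in a.
Proof.
have [[s [t st]]|h] := EM (exists s t, Node s t \in a); [by right; exists s, t|left].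
exists [fset y in pmap (@unatom U) (enum_fset a)]%fset; apply/fsetP => t.
apply/idP/imfsetP => [ta|[y /= ya ->]].
  case: t ta => [y ya|s t st]; last by case: h; exists s, t.
  by exists y => //=; rewrite in_fset /= mem_pmap; apply/mapP; exists (Atom y).
by move: ya; rewrite in_fset /= mem_pmap => /mapP[[z|//] za [->]].
Qed.

(** Links the code of a set of atoms, whose elements are doubled, to the code of the underlying set
    of numbers. The bounds make the relation decidable; [double_codeP] removes them. *)
Definition double_code (a b : nat) : Prop :=
  (forall y, y < a -> ~~ bit a y || (~~ odd y && bit b y./2)) /\
  (forall y, y < b -> ~~ bit b y || bit a y.*2).

Lemma double_codeP a b : double_code a b <-> forall y, bit a y = ~~ odd y && bit b y./2.
Proof.
split=> [[h1 h2] y|h].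
  apply/idP/andP => [ay|[ey yb]]; first by have := h1 y (bit_lt ay); rewrite ay => /andP.
  by have := h2 _ (bit_lt yb); rewrite yb /= even_halfK.
split=> y _; first by rewrite h; case: (_ && _).
by rewrite h odd_double doubleK orNb.
Qed.

Lemma double_scode (b : {fset U}) n :
  double_code (scode [fset Atom y | y in b]%fset) n <-> n = fset_code [fset th y | y in b]%fset.
Proof.
have e y : bit (scode [fset Atom y | y in b]%fset) y.*2 = (y \in [fset th y | y in b]%fset).
  apply/bit_scodeP/imfsetP => [[_ /imfsetP[z /= zb ->] /double_inj->]|[z /= zb ->]].
    by exists z.
  by exists (Atom z) => //; apply/imfsetP; exists z.
have o y : odd y -> bit (scode [fset Atom y | y in b]%fset) y = false.
  by move=> oy; apply/negP => /bit_scodeP[_ /imfsetP[z /= _ ->] ye]; rewrite ye odd_double in oy.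
rewrite double_codeP; split=> [h|-> y].
  by apply: bit_ext => y; rewrite fset_codeE -e h odd_double doubleK.
case oy: (odd y) => /=; first exact: o.
by rewrite fset_codeE -e even_halfK ?oy.
Qed.

Variables (cB cj cd : recfun).
Hypothesis cBP : forall n, eval cB [:: n] (`[< pcarrier B n >] : bool).
Hypothesis cjP : forall (a : {fset nat}) (x z : nat),
  pfun B a x = Some z <-> eval cj [:: fset_code a; x] z.
Hypothesis cdP : forall (a : {fset nat}) (x : nat),
  eval cd [:: fset_code a; x] (pfun B a x : bool).

Lemma isoN (b : {fset U}) x : [set` b] `<=` A -> pcarrier A x ->
  pfun A b x = None <-> eval cd [:: fset_code [fset th y | y in b]%fset; th x] 0.
Proof.
move=> bA Ax; have [h _] := iso.2 b x bA Ax.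
have hd := cdP [fset th y | y in b]%fset (th x).
split=> [e|/(eval_det hd)].
  by move: h hd; rewrite e; case: (pfun B _ _) => [z|//] [_ /(_ isT)].
by case: (pfun A b x) h => // z [/(_ isT)]; case: (pfun B _ _).
Qed.

Lemma isoS (b : {fset U}) x z : [set` b] `<=` A -> pcarrier A x ->
  eval cj [:: fset_code [fset th y | y in b]%fset; th x] z <->
  exists2 y, pfun A b x = Some y & z = th y.
Proof.
move=> bA Ax; have [h hz] := iso.2 b x bA Ax; rewrite -cjP; split=> [e|[y e ->]]; last exact: hz.
rewrite e in h hz; case E: (pfun A b x) h hz => [y|] [_ h] hz; last by have := h isT.
by exists y => //; have [] := hz _ erefl.
Qed.

(** Three positive reasons for being outside the domain: the argument is a pair, the set contains a
    pair, or everything is atomic and the decision procedure for the domain answers 0. *)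
Definition undef_code (a u : nat) : Prop :=
  odd u \/ (exists y, bit a y /\ odd y) \/
  exists b x, u = x.*2 /\ double_code a b /\ eval cd [:: b; x] 0.

Lemma atom_fset_sub (b : {fset U}) : [set` [fset Atom y | y in b]%fset] `<=` G -> [set` b] `<=` A.
Proof. by move=> bG y yb; apply/completion_atom; apply: bG; apply/imfsetP; exists y. Qed.

Lemma undef_codeP a t : [set` a] `<=` G -> G t ->
  undef_code (scode a) (tcode t) <-> atom_fun A a t = None.
Proof.
move=> aG; case: t => [x|s t] Gt; last by split=> // _; left; rewrite /= odd_double.
have Ax : pcarrier A x by exact/completion_atom.
have [[b ab]|[s [t st]]] := atoms_or_node a; last first.
  split=> _.
    case E: (atom_fun A a (Atom x)) => [w|//].
    by have [b [? [? [ab _ _ _]]]] := atom_fun_some E; move: st; rewrite ab => /imfsetP[].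
  right; left; exists (tcode (Node s t)); split; last by rewrite /= odd_double.
  by apply/bit_scodeP; exists (Node s t).
have bA : [set` b] `<=` A by apply: atom_fset_sub; rewrite -ab.
have -> : atom_fun A a (Atom x) = None <-> pfun A b x = None.
  by rewrite ab atom_funE; case: pfun.
rewrite isoN //; split=> [[|[[y [ya oy]]|[c [y [xy [ac h]]]]]]|h].
- by rewrite /= odd_double.
- by move: ya oy; rewrite ab => /bit_scodeP[_ /imfsetP[z _ ->] ->]; rewrite /= odd_double.
- by move: ac h; rewrite ab double_scode -(double_inj xy) => ->.
- by right; right; exists (fset_code [fset th y | y in b]%fset), (th x);
    rewrite ab double_scode.
Qed.

Definition fun_code (a u w : nat) : Prop :=
  (exists b x z, u = x.*2 /\ double_code a b /\ eval cj [:: b; x] z /\ w = z.*2) \/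
  undef_code a u /\ w = (pr a u).*2.+1.

Lemma fun_codeP a t w : [set` a] `<=` G -> G t ->
  fun_code (scode a) (tcode t) w <-> w = tcode (completion_fun A a t).
Proof.
move=> aG Gt; rewrite /fun_code undef_codeP // /completion_fun.
have key : (exists b x z, tcode t = x.*2 /\ double_code (scode a) b /\
     eval cj [:: b; x] z /\ w = z.*2) <->
    exists2 v, atom_fun A a t = Some v & w = tcode v.
  split=> [[c [y [z [ty [ac [h ->]]]]]]|[v E ->]].
    case: t Gt ty => [x|s t] Gt ty; last by move: ty => /=; lia.
    have Ax : pcarrier A x by exact/completion_atom.
    have [[b ab]|[s [t st]]] := atoms_or_node a; last first.
      have : bit (scode a) (tcode (Node s t)) by apply/bit_scodeP; exists (Node s t).
      by move/double_codeP: ac => ->; rewrite /= odd_double.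
    have bA : [set` b] `<=` A by apply: atom_fset_sub; rewrite -ab.
    move: ac h; rewrite ab double_scode -(double_inj ty) => -> /isoS[]// v bv ->.
    by exists (Atom v) => //; rewrite atom_funE bv.
  have [b [x [z [ab tx -> bz]]]] := atom_fun_some E.
  have [bA Ax Az] := pfun_closed bz.
  exists (fset_code [fset th y | y in b]%fset), (th x), (th z).
  rewrite tx ab double_scode isoS //; do !split=> //.
  by exists z.
rewrite key; case E: (atom_fun A a t) => [v|] /=.
  by split=> [[[v' [<-] //]|[]//]|->]; left; exists v.
by split=> [[[]//|[]//]|->]; right.
Qed.

(** In an application rule nothing says beforehand that [a] and [u] code carrier elements. A value
    in the carrier forces it: either [pfun B] is defined there and its domain lies in [B], or the
    value is the formal pair itself. *)
Lemma fun_code_inv a u w : G w -> fun_code a u (tcode w) ->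
  exists (b : {fset tree U}) t,
    [/\ [set` b] `<=` G, G t, scode b = a, tcode t = u & completion_fun A b t = w].
Proof.
move=> Gw [[b [x [z [-> [ab [h wz]]]]]]|[_ wau]].
  case: w Gw wz => [w|s w] Gw wz; last by move: wz => /=; lia.
  have Aw : pcarrier A w by exact/completion_atom.
  have := h; rewrite -[b]fset_of_codeK -cjP => /[dup]/pfun_closed[bB Bx Bz] e.
  have [[thA _ thS] _] := iso.
  have [x' Ax' xx'] := thS _ Bx.
  have [c cG cb] : exists2 c : {fset tree U}, [set` c] `<=` G & scode c = a.
    apply: scode_surj => k; move/double_codeP: ab => -> /andP[ek kb].
    have [y Ay yk] : (th @` A) k./2 by apply: thS; apply: bB; rewrite /= in_fset_of_code.
    by exists (Atom y); [exact/completion_atom|rewrite /= yk even_halfK].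
  exists c, (Atom x'); split=> //; [exact/completion_atom|by rewrite /= xx'|].
  have Gx' : G (Atom x') by exact/completion_atom.
  apply: tcode_inj => //; first exact: completion_closed.
  apply/esym/fun_codeP => //; left; exists b, x, z; rewrite cb /= xx'.
  by split; [|split; [|split]].
elim/completion_ind: Gw wau => [x _ /=|b t bG _ Gt _ bt]; first by lia.
rewrite tcode_opair => /succn_inj/double_inj/pr_inj[<- <-].
by exists b, t; split=> //; rewrite /completion_fun bt.
Qed.

Lemma semi_eval_list c (e : seq nat -> seq nat) f : computable_env e -> computable f ->
  semidecidable (fun xs => eval c (e xs) (f xs)).
Proof.
by move=> he hf; exact: (semi_env (semi_eval c) (env_cons hf he)).
Qed.

Lemma semi_double_code : semi2 double_code.
Proof. by rewrite /semi2 /double_code; repeat semi_step. Qed.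

Lemma semi_undef_code : semi2 undef_code.
Proof.
rewrite /semi2 /undef_code.
by repeat first [semi_step | apply: (semi2E semi_double_code) | apply: semi_eval_list].
Qed.

Lemma semi_fun_code : semi3 fun_code.
Proof.
rewrite /semi3 /fun_code.
by repeat first [semi_step | apply: (semi2E semi_double_code)
  | apply: (semi2E semi_undef_code) | apply: semi_eval_list].
Qed.

Definition carrier_rule (n Q : nat) : Prop :=
  (exists x, n = x.*2 /\ eval cB [:: x] 1) \/
  exists a u, n = (pr a u).*2.+1 /\ undef_code a u /\
    (forall y, y < a -> ~~ bit a y || bit Q y) /\ bit Q u.

Lemma carrier_generated n : generated carrier_rule n <-> carrier_code n.
Proof.
split.
  elim=> {}n Q hR _ IH; case: hR => [[x [-> h]]|[a [u [-> [au [aQ /IH[t Gt tu]]]]]]].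
    have [[_ _ thS] _] := iso.
    have [|y Ay yx] := thS x; last by exists (Atom y); [exact/completion_atom|rewrite /= yx].
    by have := eval_det (cBP x) h; case: asboolP.
  have [|b bG ba] := @scode_surj a.
    by move=> k ka; apply: IH; have := aQ k (bit_lt ka); rewrite ka.
  exists (opair b t); last by rewrite tcode_opair ba tu.
  by apply: completion_opairI => //; apply/undef_codeP; rewrite // ba tu.
move=> [t Gt <-{n}]; elim/completion_ind: Gt => [x Ax|a {}t aG IHa Gt IHt at0].
  apply: (@Generated _ _ 0) => [|q]; last by rewrite bit0.
  left; exists (th x); split=> //; have [[thA _ _] _] := iso.
  by have := cBP (th x); rewrite asboolT //; exact: thA.
apply: (@Generated _ _ (seq_code (tcode t :: map tcode (enum_fset a)))) => [|q].
  right; exists (scode a), (tcode t); split=> //; split; first exact/undef_codeP.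
  split=> [y _|]; last by rewrite bit_seq_code inE eqxx.
  by rewrite /scode !bit_seq_code inE; case: (y \in _); rewrite // orbT.
by rewrite bit_seq_code inE => /orP[/eqP->//|/mapP[u ua ->]]; exact: IHa.
Qed.

Lemma semi_carrier_code : semi1 carrier_code.
Proof.
apply: (@semi_ext (fun xs => generated carrier_rule (nth 0 xs 0))).
  by move=> xs; exact: carrier_generated.
apply: semi1_generated; rewrite /semi2 /carrier_rule.
by repeat first [semi_step | apply: (semi2E semi_undef_code) | apply: semi_eval_list].
Qed.

(* Judgements [v \in |M|_rho] are coded by [pr g (pr (godel M) v)], where the
   environment [g] is the set of the codes [pr x v] with [v \in rho x]. *)
Definition env_of (g : nat) (x : nat) : set (tree U) :=
  [set t | G t /\ bit g (pr x (tcode t))].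

(** Beyond the bound no side can hold: a bit lies below its code, a component is at most the pair,
    and [x.+1] brings [x] within range. *)
Definition update_code (g x a g' : nat) : Prop :=
  forall y, y < x.+1 + g + a + g' -> forall v, v < x.+1 + g + a + g' ->
    bit g' (pr y v) == (if y == x then bit a v else bit g (pr y v)).

(** The rules for variables, application and abstraction. Abstraction checks that [a] consists of
    carrier codes, since it ranges over finite subsets of the web; this keeps environments valid. *)
Definition derivation_rule (J Q : nat) : Prop :=
  exists g m v, J = pr g (pr m v) /\
   ((exists x, m = pr 0 x /\ bit g (pr x v)) \/
    (exists m1 m2 a w, m = pr 1 (pr m1 m2) /\ fun_code a v w /\ bit Q (pr g (pr m1 w)) /\
       forall y, y < a -> ~~ bit a y || bit Q (pr g (pr m2 y))) \/
    (exists x m1 a u g', m = pr 2 (pr x m1) /\ fun_code a u v /\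
       (forall y, y < a -> ~~ bit a y \/ carrier_code y) /\ update_code g x a g' /\
       bit Q (pr g' (pr m1 u)))).

Lemma semi_update_code : semi4 update_code.
Proof.
rewrite /semi4 /update_code; repeat semi_step.
apply: (@dec_ext (fun xs =>
   bit (nth 0 (behead (behead xs)) 3) (pr (nth 0 (behead xs) 0) (nth 0 xs 0)) ==
   ((nth 0 (behead xs) 0 == nth 0 (behead (behead xs)) 1) &&
   bit (nth 0 (behead (behead xs)) 2) (nth 0 xs 0) ||
   ~~ (nth 0 (behead xs) 0 == nth 0 (behead (behead xs)) 1) &&
   bit (nth 0 (behead (behead xs)) 0) (pr (nth 0 (behead xs) 0) (nth 0 xs 0))))).
  by move=> xs; case: (nth 0 (behead xs) 0 == _); rewrite /= ?orbF.
by apply: dec_eqb; repeat comp_step.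
Qed.

Lemma semi_derivation_rule : semi2 derivation_rule.
Proof.
rewrite /semi2 /derivation_rule.
by repeat first [semi_step | apply: (semi3E semi_fun_code)
  | apply: (semi4E semi_update_code) | apply: (semi1E semi_carrier_code)].
Qed.

Lemma leq_pr x y : (x <= pr x y) /\ (y <= pr x y).
Proof. by have := Cantor.to_nat_non_decreasing x y; lia. Qed.

Lemma update_codeP g x a g' : update_code g x a g' <->
  forall y v, bit g' (pr y v) = (if y == x then bit a v else bit g (pr y v)).
Proof.
split=> [h y v|h y _ v _]; last by rewrite h.
have [hy|hy] := ltnP y (x.+1 + g + a + g'); have [hv|hv] := ltnP v (x.+1 + g + a + g').
- exact/eqP/h.
all: have [yp vp] := leq_pr y v; apply/idP/idP => [/bit_lt|]; first by lia.
all: by case: eqP => [yx|_] /bit_lt; lia.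
Qed.

Lemma update_code_exists g x a : exists g', update_code g x a g'.
Proof.
(* The old bindings of [x] are erased and those given by [a] are added. *)
exists (seq_code ([seq n <- iota 0 g | bit g n && ((Cantor.of_nat n).1 != x)] ++
  [seq pr x v | v <- iota 0 a & bit a v])).
apply/update_codeP => y v; rewrite bit_seq_code mem_cat mem_filter Cantor.cancel_of_to.
rewrite mem_iota add0n leq0n andTb [(y, v).1]/=; case: eqP => [->|/eqP yx].
  rewrite andbF orFb; apply/mapP/idP => [[w]|av].
    by rewrite mem_filter => /andP[aw _] /pr_inj[_ ->].
  by exists v; rewrite // mem_filter av mem_iota add0n /= bit_lt.
rewrite andbT; case gyv: (bit g (pr y v)); first by rewrite bit_lt.
by rewrite andFb orFb; apply/mapP => -[w _ /pr_inj[yx' _]]; rewrite yx' eqxx in yx.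
Qed.

Definition valid_env (g : nat) : Prop := forall x v, bit g (pr x v) -> carrier_code v.

Lemma env_of_update g x a g' : [set` a] `<=` G -> update_code g x (scode a) g' ->
  env_of g' = update (env_of g) x [set` a].
Proof.
move=> aG /update_codeP h; apply/funext => y; rewrite /update /env_of.
apply/seteqP; split=> t /=; rewrite h; case: eqP => // _.
  by move=> [Gt /bit_scodeP[u ua /tcode_inj->//]]; exact: aG.
by move=> ta; split; [exact: aG|apply/bit_scodeP; exists t].
Qed.

Lemma valid_update g x a g' : valid_env g -> (forall v, bit a v -> carrier_code v) ->
  update_code g x a g' -> valid_env g'.
Proof.
by move=> vg va /update_codeP h y v; rewrite h; case: eqP => _; [exact: va|exact: vg].
Qed.

Lemma scode_carrier a v : [set` a] `<=` G -> bit (scode a) v -> carrier_code v.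
Proof. by move=> aG /bit_scodeP[t /aG Gt ->]; exists t. Qed.

(** Validity of the environment supplies an actual element in the variable case; injectivity of
    codes on the carrier then identifies the elements obtained from different premises. *)
Lemma derivation_sound g M v : valid_env g ->
  generated derivation_rule (pr g (pr (godel M) v)) ->
  exists2 t, interp (free_completion A) M (env_of g) t & tcode t = v.
Proof.
move e : (pr g _) => J vg h; elim: h g M v vg e => {}J Q hR _ IH g M v vg e.
have valG g0 : valuation (free_completion A) (env_of g0) by move=> x t [].
move: hR => [g0 [m [v0 [JE hR]]]].
move: e; rewrite JE => /pr_inj[gg /pr_inj[mM vv]]; subst g0 v0.
case: hR => [[x [mx gxv]]|[[m1 [m2 [a [w [mE [avw [h1 h2]]]]]]]|
   [x [m1 [a [u [g' [mE [auv [ha [hu h1]]]]]]]]]]].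
- have {mx}mM : godel M = pr 0 x by rewrite mM.
  case: M mM => [y|M N|y M] /= /pr_inj[] // _ ->.
  by have [t Gt tv] := vg _ _ gxv; exists t => //; split=> //; rewrite tv.
- have {mE}mM : godel M = pr 1 (pr m1 m2) by rewrite mM.
  case: M mM => [y|M N|y M] /= /pr_inj[] // _ /pr_inj[e1 e2].
  have [s hs sw] := IH _ h1 g M w vg (congr1 (fun k => pr g (pr k w)) e1).
  have Gs : G s by exact: interp_sub hs.
  rewrite -sw in avw; have [b [t [bG Gt ba tv bts]]] := fun_code_inv Gs avw.
  exists t => //; split=> //; exists b; split; last by rewrite /= bts.
  move=> r rb; have ar : bit a (tcode r) by rewrite -ba; apply/bit_scodeP; exists r.
  have hr : bit Q (pr g (pr m2 (tcode r))) by have := h2 _ (bit_lt ar); rewrite ar.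
  have [r' hr' /tcode_inj<-//] := IH _ hr g N _ vg (congr1 (fun k => pr g (pr k _)) e2).
    by apply: interp_sub hr'.
  exact: bG.
- have {mE}mM : godel M = pr 2 (pr x m1) by rewrite mM.
  case: M mM => [y|M N|y M] /= /pr_inj[] // _ /pr_inj[-> e1].
  have {}ha k : bit a k -> carrier_code k by move=> ak; case: (ha _ (bit_lt ak)) => //; rewrite ak.
  have [b bG ba] := scode_surj ha.
  have vg' := valid_update vg ha hu.
  have [t ht tu] := IH _ h1 g' M u vg' (congr1 (fun k => pr g' (pr k u)) e1).
  have Gt : G t by exact: interp_sub ht.
  rewrite -ba in hu auv; rewrite -tu in auv; move/fun_codeP: auv => -> //.
  exists (completion_fun A b t) => //; exists b, t; split=> //.
  by rewrite -(env_of_update bG hu).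
Qed.

Lemma derivation_complete g M t : valid_env g -> interp (free_completion A) M (env_of g) t ->
  generated derivation_rule (pr g (pr (godel M) (tcode t))).
Proof.
have valG g0 : valuation (free_completion A) (env_of g0) by move=> x u [].
elim: M g t => [x|M IHM N IHN|x M IH] g t vg /=.
- move=> [Gt gt]; apply: (@Generated _ _ 0) => [|q]; last by rewrite bit0.
  exists g, (pr 0 x), (tcode t); split=> //; left; by exists x.
- move=> [Gt [a [ha ht]]].
  have aG : [set` a] `<=` G by apply: subset_trans ha _; exact: interp_sub.
  apply: (@Generated _ _ (seq_code (pr g (pr (godel M) (tcode (completion_fun A a t))) ::
     [seq pr g (pr (godel N) (tcode u)) | u <- enum_fset a]))) => [|q].
    exists g, (pr 1 (pr (godel M) (godel N))), (tcode t); split=> //; right; left.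
    exists (godel M), (godel N), (scode a), (tcode (completion_fun A a t)); split=> //.
    split; first exact/fun_codeP.
    rewrite bit_seq_code inE eqxx; split=> // y _; rewrite bit_seq_code inE.
    case: bit_scodeP => //= -[u ua ->]; apply/orP; right; apply/mapP; by exists u.
  rewrite bit_seq_code inE => /orP[/eqP->|/mapP[u ua ->]]; first exact: IHM.
  by apply: IHN => //; exact: ha.
- move=> [a [u [aG hu ->]]]; have Gu : G u.
    by apply: interp_sub hu; apply: update_valuation.
  have [g' hg'] := update_code_exists g x (scode a).
  apply: (@Generated _ _ (seq_code [:: pr g' (pr (godel M) (tcode u))])) => [|q].
    exists g, (pr 2 (pr x (godel M))), (tcode (completion_fun A a u)); split=> //; right; right.
    exists x, (godel M), (scode a), (tcode u), g'; split=> //; split; first exact/fun_codeP.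
    split=> [y _|]; first by case ay: (bit (scode a) y); [right; exact: scode_carrier ay|left].
    by split=> //; rewrite bit_seq_code inE.
  rewrite bit_seq_code inE => /eqP->; apply: IH; last by rewrite (env_of_update aG hg').
  by apply: valid_update hg' => // v; exact: scode_carrier.
Qed.

(** * Semidecidability of membership and of escape from [E] *)

Definition membership_code (m v : nat) : Prop := generated derivation_rule (pr 0 (pr m v)).

Lemma semi_membership_code : semi2 membership_code.
Proof.
by apply: (semi1E (semi1_generated semi_derivation_rule)); repeat comp_step.
Qed.

Lemma membership_codeP M v : membership_code (godel M) v <->
  exists2 t, closed_interp (free_completion A) M t & tcode t = v.
Proof.
have v0 : valid_env 0 by move=> x w; rewrite bit0.
have e0 : env_of 0 = (fun=> set0).
  by apply/funext => x; apply/seteqP; split=> t [] //; rewrite bit0.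
by rewrite /closed_interp -e0; split=> [/(derivation_sound v0)|[t ht <-]] //; exact: derivation_complete.
Qed.

(** A witness of escape is either a formal pair, recognised by its odd code, or an atom outside the
    set, recognised because the set is co-r.e. *)
Definition escape_code (F : set nat) (m : nat) : Prop :=
  exists v, membership_code m v /\ (odd v \/ exists x, v = x.*2 /\ (~` F) x).

Lemma semi_escape_code F : co_re_set F -> semi1 (escape_code F).
Proof.
move=> /semi_re_set hF; rewrite /semi1 /escape_code.
by repeat first [semi_step | apply: (semi2E semi_membership_code) | apply: (semi1E hF)].
Qed.

Lemma escape_codeP E M : E `<=` A -> escape_code [set th x | x in E] (godel M) <->
  ~ (closed_interp (free_completion A) M `<=` [set Atom x | x in E]).
Proof.
move=> EA; split=> [[v [/membership_codeP[t ht <-] ho]] /(_ t ht) [x Ex tx]|].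
  case: ho => [|[y [yt]]]; first by rewrite -tx /= odd_double.
  by apply; exists x => //; apply: double_inj; rewrite -yt -tx.
move=> /existsNP[t /not_implyP[ht tE]].
exists (tcode t); split; first by apply/membership_codeP; exists t.
case: t ht tE => [x|s t] ht tE; last by left; rewrite /= odd_double.
right; exists (th x); split=> // -[y Ey yx]; apply: tE; exists y => //.
congr Atom; apply: th_inj => //; first exact: EA.
by apply/completion_atom; apply: interp_sub ht => k u [].
Qed.

End Coding.

(** * Automorphisms *)

Section Automorphism.
Variables (U : choiceType) (A : partial_pair U) (th : U -> U).
Hypothesis aut : automorphism A th.
Local Notation G := (completion_carrier A).

(** The image of a node is rebuilt through a finite set, because mapping a canonical enumeration
    need not give a canonical one. *)
Fixpoint tmap (t : tree U) : tree U :=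
  match t with
  | Atom x => Atom (th x)
  | Node s t => opair [fset u in map tmap s]%fset (tmap t)
  end.

Definition tmap_fset (a : {fset tree U}) : {fset tree U} := [fset tmap u | u in a]%fset.

Lemma tmap_opair a t : tmap (opair a t) = opair (tmap_fset a) (tmap t).
Proof.
rewrite /=; congr opair; apply/fsetP => u; rewrite in_fset.
by apply/mapP/imfsetP => -[v va ->]; exists v.
Qed.

Lemma tmap_fset_atom (b : {fset U}) :
  tmap_fset [fset Atom y | y in b]%fset = [fset Atom y | y in [fset th y | y in b]]%fset.
Proof.
apply/fsetP => u; apply/imfsetP/imfsetP => /= -[_ /imfsetP[y /= yb ->] ->].
  by exists (th y) => //; apply/imfsetP; exists y.
by exists (Atom y) => //; apply/imfsetP; exists y.
Qed.

(** An automorphism preserves and reflects definedness, so a formal pair stays formal. Sets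
    containing a node are settled by shape: [tmap] never turns a node into an atom. *)
Lemma tmap_atom_fun a t : [set` a] `<=` G -> G t ->
  atom_fun A (tmap_fset a) (tmap t) = omap tmap (atom_fun A a t).
Proof.
move=> aG Gt; case E: (atom_fun A a t) => [w|] /=.
  have [b [x [z [-> -> -> bz]]]] := atom_fun_some E.
  have [bA Ax _] := pfun_closed bz.
  by rewrite tmap_fset_atom atom_funE (proj2 (aut.2 b x bA Ax) _ bz).
case F: (atom_fun A (tmap_fset a) (tmap t)) => [w|//].
have [b' [x' [z' [ab' tx' _ _]]]] := atom_fun_some F.
case: t Gt E F tx' => // x Gx E F _.
have [[b ab]|[s [t st]]] := atoms_or_node a; last first.
  have : tmap (Node s t) \in tmap_fset a by apply/imfsetP; exists (Node s t).
  by rewrite ab' => /imfsetP[].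
have Ax : pcarrier A x by exact/completion_atom.
have bA : [set` b] `<=` A by apply: atom_fset_sub; rewrite -ab.
have [h _] := aut.2 b x bA Ax.
move: E F; rewrite ab tmap_fset_atom !atom_funE => E F.
by case: (pfun A b x) E h => // _ [_]; case: (pfun A _ _) F => // y _ /(_ isT).
Qed.

Lemma tmap_completion_fun a t : [set` a] `<=` G -> G t ->
  tmap (completion_fun A a t) = completion_fun A (tmap_fset a) (tmap t).
Proof.
move=> aG Gt; rewrite /completion_fun tmap_atom_fun //.
by case: (atom_fun A a t) => //=; rewrite -tmap_opair.
Qed.

Lemma tmap_carrier t : G t -> G (tmap t).
Proof.
elim/completion_ind => [x Ax|a {}t aG IHa Gt IHt at0].
  by apply/completion_atom; have [[thA _ _] _] := aut; exact: thA.
rewrite tmap_opair; apply: completion_opairI => //; last by rewrite tmap_atom_fun // at0.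
by move=> _ /imfsetP[u ua ->]; exact: IHa.
Qed.

Lemma tmap_fset_carrier a : [set` a] `<=` G -> [set` tmap_fset a] `<=` G.
Proof. by move=> aG _ /imfsetP[u ua ->]; apply: tmap_carrier; exact: aG. Qed.

Lemma tmap_interp M (rho : nat -> set (tree U)) t : valuation (free_completion A) rho ->
  interp (free_completion A) M rho t ->
  interp (free_completion A) M (fun x => tmap @` rho x) (tmap t).
Proof.
elim: M rho t => [x|M IHM N IHN|x M IH] rho t hr /=; first by move=> h; exists t.
  move=> [Gt [a [ha ht]]]; split; first exact: tmap_carrier.
  have aG : [set` a] `<=` G by apply: subset_trans ha _; exact: interp_sub.
  exists (tmap_fset a); split; last by rewrite -tmap_completion_fun //; exact: IHM.
  by move=> _ /imfsetP[u ua ->]; apply: IHN => //; exact: ha.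
move=> [a [v [aG hv ->]]].
have hr' : valuation (free_completion A) (update rho x [set` a]) by exact: update_valuation.
have Gv : G v by exact: interp_sub hv.
exists (tmap_fset a), (tmap v); split; [exact: tmap_fset_carrier| |exact: tmap_completion_fun].
apply: interp_mono (IH _ _ hr' hv) => y _ [u hu <-]; move: hu; rewrite /update.
case: eqP => [_ ua|_ hu]; last by exists u.
by apply/imfsetP; exists u.
Qed.

Lemma tmap_closed_interp M t : closed_interp (free_completion A) M t ->
  closed_interp (free_completion A) M (tmap t).
Proof.
move=> /(tmap_interp (fun _ => @sub0set _ _)); apply: interp_mono => x u [] //.
Qed.

End Automorphism.

(** * Orbits under automorphisms *)

Section Orbits.
Variables (U : choiceType) (A : partial_pair U).

Lemma automorphism_id : automorphism A id.
Proof.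
split; first by split=> // x Ax; exists x.
have e (a : {fset U}) : [fset id y | y in a]%fset = a.
  by apply/fsetP => x; apply/imfsetP/idP => [[y ya ->]//|xa]; exists x.
by move=> a x _ _; rewrite e.
Qed.

Lemma orbit_refl x : aut_orbit A x x.
Proof. by exists id => //; exact: automorphism_id. Qed.

Lemma closed_interp_orbit M x y : closed_interp (free_completion A) M (Atom x) ->
  aut_orbit A x y -> closed_interp (free_completion A) M (Atom y).
Proof. by move=> hx [th ath <-]; exact: (tmap_closed_interp ath hx). Qed.

(* Below [E], the interpretation of a closed term is a union of orbits, of which
   there are finitely many. *)
Lemma closed_interp_below_finite (E : set U) : finite_set (aut_orbits A E) ->
  exists k (v : term -> {set 'I_k}), forall M N,
    closed_interp (free_completion A) M `<=` [set Atom x | x in E] ->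
    closed_interp (free_completion A) N `<=` [set Atom x | x in E] ->
    v M = v N -> closed_interp (free_completion A) M = closed_interp (free_completion A) N.
Proof.
move=> /finite_setP[k /card_set_bijP[phi [phiF phi_inj _]]].
(* The value [v M] records which orbits, numbered by [phi], the interpretation of [M] meets. *)
exists k, (fun M => [set i : 'I_k | `[< exists2 x, closed_interp (free_completion A) M (Atom x) &
  val i = phi (aut_orbit A x) >]])%SET => M N.
suff H M' N' : closed_interp (free_completion A) M' `<=` [set Atom x | x in E] ->
    closed_interp (free_completion A) N' `<=` [set Atom x | x in E] ->
    (forall i : 'I_k, (exists2 x, closed_interp (free_completion A) M' (Atom x) &
       val i = phi (aut_orbit A x)) -> (exists2 x, closed_interp (free_completion A) N' (Atom x) &
       val i = phi (aut_orbit A x))) ->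
    closed_interp (free_completion A) M' `<=` closed_interp (free_completion A) N'.
  move=> ME NE /setP vv; apply/seteqP; split; apply: H => // i h; have := vv i.
    by rewrite !inE => e; apply/asboolP; rewrite -e; exact/asboolP.
  by rewrite !inE => e; apply/asboolP; rewrite e; exact/asboolP.
move=> ME NE h t Mt; have [x Ex xt] := ME t Mt; rewrite -xt in Mt *.
have Fx : aut_orbits A E (aut_orbit A x) by exists x.
have [y Ny xy] := h (Ordinal (phiF _ Fx)) (ex_intro2 _ _ x Mt erefl).
have [z Ez [yz]] := NE _ Ny; rewrite -yz in Ny xy.
apply: closed_interp_orbit Ny _.
have -> : aut_orbit A z = aut_orbit A x; last exact: orbit_refl.
by apply: phi_inj; rewrite ?inE //; exists z.
Qed.

End Orbits.

(** * Non-enumerability of the theory *)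

Lemma semi1_has (T : eqType) (P : T -> nat -> Prop) (s : seq T) :
  (forall x, semi1 (P x)) -> semi1 (fun n => exists2 x, x \in s & P x n).
Proof.
move=> hP; elim: s => [|x s IH] /=.
  apply: (@semi_ext (fun=> false)); first by move=> xs; split=> // -[].
  by apply: semi_dec; exact: computable_const.
apply: semi_ext (semi_or (hP x) IH) => xs; split=> [[h|[y ys h]]|[y]].
- by exists x; rewrite // mem_head.
- by exists y; rewrite // inE ys orbT.
- by rewrite inE => /orP[/eqP->|ys] h; [left|right; exists y].
Qed.

Lemma godel_inj : injective godel.
Proof.
elim=> [x|M IHM N IHN|x M IH] [y|M' N'|y M'] /= /pr_inj[] // _.
- by move=> ->.
- by move=> /pr_inj[/IHM-> /IHN->].
- by move=> /pr_inj[-> /IH->].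
Qed.

Lemma equational_theory_closed (V : choiceType) (G : total_pair V) M N :
  closed_term M -> closed_term N ->
  equational_theory G (M, N) <-> closed_interp G M = closed_interp G N.
Proof.
move=> cM cN; split=> [/(_ (fun=> set0))|e rho _]; first by apply=> ?; exact: sub0set.
by rewrite !interp_closed.
Qed.

Theorem theorem12p11 (U : choiceType) (A : partial_pair U)
    (B : partial_pair nat) (th : U -> nat)
    (A_eff : weakly_effective_via A B th) :
  (exists E : set U,
     [/\ E `<=` A,
         co_re_set [set th x | x in E],
         closed_terms_below A E !=set0
       & finite_set (aut_orbits A E)]) ->
  ~ re_theory (equational_theory (free_completion A)).
Proof.
move=> [E [EA coE [N0 [cN0 N0E]] finE]] /semi_re_set reT.
have [[[cB cBP] [cj cjP] [cd cdP]] iso] := A_eff.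
pose O M := closed_interp (free_completion A) M `<=` [set Atom x | x in E].
have [k [v vP]] := closed_interp_below_finite finE.
(* One representative for each possible value of [v]; where the value is not attained in [O], the
   default is [N0], and the last clause is vacuous. *)
have /choice[f hf] : forall X : {set 'I_k}, exists N, (closed_term N /\ O N) /\
    forall M, closed_term M -> O M -> v M = X -> v N = X.
  move=> X; have [[M [cM [OM vM]]]|nM] := EM (exists M, closed_term M /\ (O M /\ v M = X)).
    by exists M.
  by exists N0; split=> // M cM OM vM; case: nM; exists M.
pose T n m := [set Cantor.to_nat (godel MN.1, godel MN.2)
  | MN in equational_theory (free_completion A)] (pr n m).
have TP M N : closed_term M -> closed_term N ->
    T (godel M) (godel N) <-> closed_interp (free_completion A) M = closed_interp (free_completion A) N.
  move=> cM cN; rewrite -equational_theory_closed //; split=> [[[M' N'] h]|h]; last by exists (M, N).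
  by move=> /pr_inj[/godel_inj<- /godel_inj<-].
(* A closed term is in [O] exactly when the theory equates it with one of the representatives. *)
pose P n := exists2 X, X \in enum {set 'I_k} & T n (godel (f X)).
have allO M : closed_term M -> O M.
  move=> cM; apply: (@scott_undecidable _ (free_completion A) O P
     (escape_code A th cj cd [set th x | x in E]) N0 M) => // {M cM}.
  - by move=> M N _ _; rewrite /O => ->.
  - apply: (@semi1_has _ (fun X n => T n (godel (f X)))) => X.
    by apply: (semi1E reT); repeat comp_step.
  - exact: (semi_escape_code iso cj cBP cdP coE).
  - move=> M cM; split=> [[X _]|OM].
      have [[cf Of] _] := hf X.
      by rewrite TP // /O => ->.
    have [[cf Of] /(_ M cM OM erefl) e] := hf (v M).
    by exists (v M); [rewrite mem_enum|rewrite TP //; apply: vP].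
  - by move=> M cM; exact: (escape_codeP iso cjP cdP).
(* Pigeonhole: one numeral more than there are possible values of [v]. *)
pose w (i : 'I_#|{set 'I_k}|.+1) := v (tnum i).
have winj : injective w.
  move=> i j wij; apply: val_inj => /=.
  apply: (@num_inj _ (free_completion A)); apply: domainP.
  by apply: (vP _ _ _ _ wij); apply: allO; exact: closed_tnum.
by have := leq_card w winj; rewrite card_ord ltnn.
Qed.
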